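(* Fix an integer $k\ge0$. Let $G$ be a $k$-partially walk-regular graph on $n$ vertices with adjacency eigenvalues $\lambda_1\ge\cdots\ge\lambda_n$. There is an algorithm which, given the spectrum of $G$ (distinct eigenvalues with multiplicities), solves the optimization problem $$\nu_k(G)=\max_{p\in\mathbb R_k[x]}\left(1+\frac{|\{i:p(\lambda_i)<0\}|}{|\{i:p(\lambda_i)>0\}|}\right)\quad\text{subject to}\quad \sum_{i=1}^n p(\lambda_i)=0,$$ where polynomials with $|\{i:p(\lambda_i)>0\}|=0$ are discarded, in time polynomial in $n$.
   Context: A graph $G$ with adjacency matrix $A$ is $k$-partially walk-regular if for every $\ell=0,\ldots,k$ the diagonal entry $(A^\ell)_{vv}$ (the number of closed walks of length $\ell$ at $v$) is independent of the vertex $v$. $\mathbb R_k[x]$ is the set of real polynomials of degree at most $k$. Eigenvalue counts are with multiplicity. *)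

(* Defs.v *)
From HB Require Import structures.
From mathcomp Require Import all_boot all_order all_algebra.
From mathcomp Require Import reals.
Set Implicit Arguments.
Unset Strict Implicit.
Unset Printing Implicit Defensive.
Import Order.TTheory GRing.Theory Num.Theory.
Local Open Scope ring_scope.

(* Time is measured on a uniform real random-access machine (the BSS model with
   indirect addressing): real cells [rmem s a], and natural-number index
   registers [ireg s i] that serve as addresses and counters.  Every elementary
   instruction and every test costs 1.  There is no floor or other conversion
   from reals to indices, and indices only support addition and truncated
   subtraction, so that their bit length grows at most linearly in time.  The
   only constants in programs are natural numbers. *)

Record state (R : Type) := State { ireg : nat -> nat; rmem : nat -> R }.

Definition upd (T : Type) (f : nat -> T) (a : nat) (x : T) : nat -> T :=
  fun b => if b == a then x else f b.

Inductive iop := IAdd | ISub.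
Inductive rop := RAdd | RSub | RMul | RDiv.

(* Real operands are always addressed indirectly: the argument [i] of a real
   instruction denotes the cell whose address is held in index register [i]. *)
Inductive test :=
  | ILt of nat & nat
  | RLt of nat & nat.

Inductive cmd :=
  | Skip
  | ILit of nat & nat
  | IOp of iop & nat & nat & nat
  | RLit of nat & nat
  | RMov of nat & nat
  | ROp of rop & nat & nat & nat
  | Seq of cmd & cmd
  | If of test & cmd & cmd
  | While of test & cmd.

Section Semantics.
Variable R : realType.
Implicit Types (s : state R) (c : cmd) (b : test).

Definition cell s (i : nat) : R := rmem s (ireg s i).

Definition set_ireg s (i v : nat) : state R :=
  State (upd (ireg s) i v) (rmem s).

Definition set_cell s (i : nat) (x : R) : state R :=
  State (ireg s) (upd (rmem s) (ireg s i) x).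

Definition iop_eval (o : iop) (x y : nat) : nat :=
  match o with IAdd => (x + y)%N | ISub => (x - y)%N end.

Definition rop_eval (o : rop) (x y : R) : R :=
  match o with
  | RAdd => x + y | RSub => x - y | RMul => x * y | RDiv => x / y
  end.

(* Division by zero blocks the machine. *)
Definition rop_defined (o : rop) (y : R) : bool :=
  if o is RDiv then y != 0 else true.

Definition test_eval b s : bool :=
  match b with
  | ILt i j => (ireg s i < ireg s j)%N
  | RLt i j => cell s i < cell s j
  end.

(* [exec c s t s']: started in [s], the program [c] halts in [s'] after exactly
   [t] steps. *)
Inductive exec : cmd -> state R -> nat -> state R -> Prop :=
  | exec_Skip s : exec Skip s 1 s
  | exec_ILit s i v : exec (ILit i v) s 1 (set_ireg s i v)
  | exec_IOp s o i j l :
      exec (IOp o i j l) s 1 (set_ireg s i (iop_eval o (ireg s j) (ireg s l)))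
  | exec_RLit s i v : exec (RLit i v) s 1 (set_cell s i v%:R)
  | exec_RMov s i j : exec (RMov i j) s 1 (set_cell s i (cell s j))
  | exec_ROp s o i j l :
      rop_defined o (cell s l) ->
      exec (ROp o i j l) s 1 (set_cell s i (rop_eval o (cell s j) (cell s l)))
  | exec_Seq s1 s2 s3 c1 c2 t1 t2 :
      exec c1 s1 t1 s2 -> exec c2 s2 t2 s3 ->
      exec (Seq c1 c2) s1 (t1 + t2)%N s3
  | exec_IfT s s' b c1 c2 t :
      test_eval b s -> exec c1 s t s' -> exec (If b c1 c2) s t.+1 s'
  | exec_IfF s s' b c1 c2 t :
      ~~ test_eval b s -> exec c2 s t s' -> exec (If b c1 c2) s t.+1 s'
  | exec_WhileF s b c :
      ~~ test_eval b s -> exec (While b c) s 1 s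
  | exec_WhileT s1 s2 s3 b c t1 t2 :
      test_eval b s1 -> exec c s1 t1 s2 -> exec (While b c) s2 t2 s3 ->
      exec (While b c) s1 (t1 + t2)%N.+1 s3.

Lemma exec_det c s t1 s1 t2 s2 :
  exec c s t1 s1 -> exec c s t2 s2 -> t1 = t2 /\ s1 = s2.
Proof.
have absurd (b : bool) : b -> ~~ b -> False by move=> ->.
move=> h; elim: h t2 s2 => {c s t1 s1}; try by [move=> *; match goal with
  h : exec _ _ _ _ |- _ => inversion h end].
- move=> s1 s2 s3 c1 c2 t1 t2 _ ih1 _ ih2 t s h; inversion h as
    [| | | | | |? s2' ? ? ? t1' t2' h1 h2| | | |]; subst.
  by have [? ?] := ih1 _ _ h1; subst; have [? ?] := ih2 _ _ h2; subst.
- move=> s s' b c1 c2 t hb _ ih t2 s2 h; inversion h; subst;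
    last by exfalso; eauto.
  by have [? ?] : t = t0 /\ s' = s2 by [apply: ih]; subst.
- move=> s s' b c1 c2 t hb _ ih t2 s2 h; inversion h; subst;
    first by exfalso; eauto.
  by have [? ?] : t = t0 /\ s' = s2 by [apply: ih]; subst.
- by move=> s b c hb t2 s2 h; inversion h; subst => //; exfalso; eauto.
- move=> s1 s2 s3 b c t1 t2 hb _ ih1 _ ih2 t s h; inversion h as
    [| | | | | | | | | |? s2' ? ? ? t1' t2' hb' h1 h2]; subst;
    first by exfalso; eauto.
  by have [? ?] := ih1 _ _ h1; subst; have [? ?] := ih2 _ _ h2; subst.
Qed.

End Semantics.

Section Graphs.
Variables (R : realType) (n : nat).

Definition adjacency (e : rel 'I_n) : 'M[R]_n := \matrix_(i, j) (e i j)%:R.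

Definition partially_walk_regular (k : nat) (e : rel 'I_n) : Prop :=
  forall l, (l <= k)%N ->
  forall u v : 'I_n, (adjacency e ^+ l) u u = (adjacency e ^+ l) v v.

Definition adjacency_eigenvalues (e : rel 'I_n) (lam : n.-tuple R) : Prop :=
  sorted >=%R lam /\
  char_poly (adjacency e) = \prod_(x <- lam) ('X - x%:P).

End Graphs.

Section Problem.
Variables (R : realType) (n : nat).
Implicit Types (lam : n.-tuple R) (p : {poly R}).

Definition npos lam p : nat := #|[set i | 0 < p.[tnth lam i]]|.
Definition nneg lam p : nat := #|[set i | p.[tnth lam i] < 0]|.

Definition feasible (k : nat) lam p : Prop :=
  [/\ (size p <= k.+1)%N,
      \sum_(i < n) p.[tnth lam i] = 0
    & npos lam p != 0%N].

Definition objective lam p : R := 1 + (nneg lam p)%:R / (npos lam p)%:R.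

Definition optimal (k : nat) lam p : Prop :=
  feasible k lam p /\
  forall q, feasible k lam q -> objective lam q <= objective lam p.

(* The spectrum theta_0^(m_0), ..., theta_d^(m_d) is stored in cells 0 to 2d+1
   as theta_0, m_0, ..., theta_d, m_d, and index register 0 holds d+1. *)
Definition spectrum_input lam : state R :=
  let sp := tally lam in
  State (upd (fun=> 0%N) 0%N (size sp))
        (nth 0 (flatten [seq [:: x.1; x.2%:R] | x <- sp])).

(* Index register 0 is the feasibility flag.  If it is 1, cell 0 holds nu_k and
   cells 1 to k+1 hold the coefficients of a maximizer.  There may be no
   feasible polynomial at all (for k = 0, or for an edgeless graph), and the
   flag is then 0. *)
Definition solves_nu (k : nat) lam (s : state R) : Prop :=
  (exists p, [/\ optimal k lam p, ireg s 0%N = 1%N, rmem s 0%N = objective lam p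
               & forall j, (j <= k)%N -> rmem s j.+1 = p`_j])
  \/ (~ (exists p, feasible k lam p) /\ ireg s 0%N = 0%N).

End Problem.

(* Main.v *)
Require Import Defs.
From HB Require Import structures.
From mathcomp Require Import all_boot all_order all_algebra.
From mathcomp Require Import reals boolp.
From mathcomp Require Import lra zify.
Set Implicit Arguments.
Unset Strict Implicit.
Unset Printing Implicit Defensive.
Import Order.TTheory GRing.Theory Num.Theory.
Local Open Scope ring_scope.

(** Write [theta_j], [m_j] for the distinct eigenvalues and their multiplicities,
    and [wsum p] for the sum of the [m_j * p(theta_j)].  After scaling, a feasible
    [p] lies in the polyhedron of the [q] of degree at most [k] such that
    [wsum q = 0] and each [q(theta_j)] is [0], [>= 1] or [<= -1], according to the
    sign of [p(theta_j)].  All its points have the same objective value as [p],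
    and a point with a maximal set of tight constraints is determined, on the
    spectrum, by prescribing values in [{0, 1, -1}] at some [r <= k] eigenvalues:
    it is the Newton interpolant of these values plus the multiple of the node
    polynomial that makes [wsum] vanish.  Hence it suffices to try all choices of
    at most [k] eigenvalues and of their prescribed values, which are polynomially
    many for fixed [k]. *)

(** * Vertices of the sign polyhedron *)

(** Scaling replaces strict sign conditions by closed ones, so that a motion can be stopped exactly
    before a sign is lost. The objective sees only signs, hence nothing is optimized along the way:
    the motion merely collects tight nodes. The obstacle is the last step, the division by [wsum w]
    for the node polynomial [w], which may vanish at a careless choice of nodes. So only a maximal
    set [I] of at most [k] tight nodes with [wsum w != 0] is interpolated; the empty set qualifies,
    the total weight being positive. If [I] has [k] elements, a polynomial of degree at most [k]
    that vanishes on [I] is a multiple of [w], and [wsum] decides which. If [I] is smaller, all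
    other tight nodes equal a single number [c]; by rigidity [w] times [X - c] vanishes on the
    spectrum, and the positive weight at [c] fixes the last value. Trying all choices needs only
    loops over the spectrum, nested to a depth that depends on [k] alone, so the time bound can be
    read off the program text. *)

Lemma seq_argmin (T : eqType) (R : realDomainType) (D : pred T) (f : T -> R)
    (s : seq T) x0 :
  x0 \in s -> D x0 ->
  exists2 x, (x \in s) && D x & {in s, forall y, D y -> f x <= f y}.
Proof.
elim: s x0 => [//|a s IH] x0; rewrite inE.
have [/hasP[b bs Db] _ _|/hasPn noD] := boolP (has D s).
  have [x /andP[xs Dx] minx] := IH b bs Db.
  have [/andP[Da lt_ax]|] := boolP (D a && (f a < f x)).
    exists a => [|y]; first by rewrite mem_head.
    rewrite inE => /predU1P[-> //|ys Dy].
    exact: le_trans (ltW lt_ax) (minx y ys Dy).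
  move=> NDa; exists x => [|y]; first by rewrite inE xs Dx orbT.
  rewrite inE => /predU1P[-> Da|]; last exact: minx.
  by rewrite leNgt; apply: contra NDa => ->; rewrite Da.
move=> /predU1P[->|x0s] Dx0; last by have := noD _ x0s; rewrite Dx0.
exists a => [|y]; first by rewrite mem_head.
by rewrite inE => /predU1P[-> //|/noD/negPf->].
Qed.

Section WeightedSum.
Variables (R : realType) (sp : seq (R * R)).
Implicit Types (p q h w : {poly R}).

Definition wsum p : R := \sum_(x <- sp) x.2 * p.[x.1].

Definition wpos p : R := \sum_(x <- sp | 0 < p.[x.1]) x.2.

Definition wneg p : R := \sum_(x <- sp | p.[x.1] < 0) x.2.

Lemma wsumD p q : wsum (p + q) = wsum p + wsum q.
Proof.
by rewrite -big_split /=; apply: eq_bigr => x _; rewrite hornerD mulrDr.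
Qed.

Lemma wsumZ c p : wsum (c *: p) = c * wsum p.
Proof.
by rewrite mulr_sumr; apply: eq_bigr => x _; rewrite hornerZ mulrCA.
Qed.

Lemma wsumB p q : wsum (p - q) = wsum p - wsum q.
Proof. by rewrite -scaleN1r wsumD wsumZ mulN1r. Qed.

Lemma eq_wpos p q :
  {in sp, forall x, Num.sg p.[x.1] = Num.sg q.[x.1]} -> wpos p = wpos q.
Proof.
move=> eq_pq; rewrite /wpos big_seq_cond [RHS]big_seq_cond.
apply: eq_bigl => x; case: (boolP (x \in sp)) => //= /eq_pq eq_x.
by rewrite -sgr_gt0 eq_x sgr_gt0.
Qed.

Lemma eq_wneg p q :
  {in sp, forall x, Num.sg p.[x.1] = Num.sg q.[x.1]} -> wneg p = wneg q.
Proof.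
move=> eq_pq; rewrite /wneg big_seq_cond [RHS]big_seq_cond.
apply: eq_bigl => x; case: (boolP (x \in sp)) => //= /eq_pq eq_x.
by rewrite -sgr_lt0 eq_x sgr_lt0.
Qed.

Section Rigid.
Variable k : nat.

Definition tight p : pred R := fun x => (p.[x] == 0) || (`|p.[x]| == 1).

(* [p] is then a vertex of the polyhedron of all [q] with [wsum q = 0] whose
   value at each node is [0], at least [1] or at most [-1], as that of [p]. *)
Definition rigid p : Prop :=
  forall h, (size h <= k.+1)%N -> wsum h = 0 ->
    {in sp, forall x, tight p x.1 -> h.[x.1] = 0} ->
    {in sp, forall x, h.[x.1] = 0}.

Definition unit_normal p : Prop :=
  {in sp, forall x, p.[x.1] = 0 \/ 1 <= `|p.[x.1]|}.

Lemma unit_normal_exists p :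
  exists2 c, 0 < c & unit_normal (c *: p).
Proof.
(* The sum dominates each single inverse; inverses of zero values are [0], and the leading [1] keeps
   the factor positive. *)
exists (1 + \sum_(x <- sp) `|p.[x.1]|^-1).
  by rewrite ltr_wpDr ?ltr01 // sumr_ge0 // => x _; rewrite invr_ge0.
move=> x xsp; have [px0|px0] := eqVneq p.[x.1] 0.
  by left; rewrite hornerZ px0 mulr0.
right; rewrite hornerZ normrM (big_rem x xsp) /=.
rewrite ger0_norm; last first.
  by rewrite addr_ge0 // addr_ge0 ?sumr_ge0 // => *; rewrite invr_ge0.
rewrite addrCA mulrDl mulVf ?normr_eq0 // lerDl mulr_ge0 //.
by rewrite addr_ge0 // sumr_ge0 // => *; rewrite invr_ge0.
Qed.

(** The ratio test of linear programming: [h] fixes the tight nodes and pulls the value at [x0]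
    towards [0], so along [p + t *: h] some further value must reach [1] or [-1]. The first one to
    do so stops the motion before any sign changes. *)
Lemma unit_normal_tighten p h (x0 : R * R) :
  unit_normal p -> {in sp, forall x, tight p x.1 -> h.[x.1] = 0} ->
  x0 \in sp -> h.[x0.1] * p.[x0.1] < 0 ->
  exists t, let q := p + t *: h in
  [/\ unit_normal q, {in sp, forall x, Num.sg q.[x.1] = Num.sg p.[x.1]},
      {in sp, forall x, tight p x.1 -> tight q x.1}
    & exists x, [/\ x \in sp, ~~ tight p x.1 & tight q x.1]].
Proof.
move=> un hT x0sp neg0.
have [x1 /andP[x1sp neg1] min1] := seq_argmin
  (D := fun x : R * R => h.[x.1] * p.[x.1] < 0)
  (fun x : R * R => (`|p.[x.1]| - 1) / `|h.[x.1]|) x0sp neg0.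
have gt1 x : x \in sp -> h.[x.1] * p.[x.1] < 0 -> 1 < `|p.[x.1]|.
  move=> xsp neg; have [px0|] := un x xsp.
    by move: neg; rewrite px0 mulr0 ltxx.
  rewrite le_eqVlt => /predU1P[p1|//].
  by move: neg; rewrite hT ?mul0r ?ltxx // /tight -p1 eqxx orbT.
have hn0 x : h.[x.1] * p.[x.1] < 0 -> 0 < `|h.[x.1]|.
  by move=> neg; rewrite normr_gt0; apply: contraTneq neg => ->; rewrite mul0r ltxx.
set t := (`|p.[x1.1]| - 1) / `|h.[x1.1]|.
have t_gt0 : 0 < t by rewrite divr_gt0 ?hn0 // subr_gt0 gt1.
have qE x : (p + t *: h).[x] = p.[x] + t * h.[x] by rewrite hornerD hornerZ.
have shrink x : x \in sp -> h.[x.1] * p.[x.1] < 0 ->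
    t * `|h.[x.1]| <= `|p.[x.1]| - 1.
  by move=> xsp neg; rewrite -ler_pdivlMr ?hn0 //; apply: min1.
(* Where [h] and [p] have equal signs the absolute value grows; where the signs differ, minimality
   of [t] keeps it at least [1]. *)
have fate x : x \in sp ->
    h.[x.1] = 0 \/ (1 <= `|p.[x.1] + t * h.[x.1]|) /\
      Num.sg (p.[x.1] + t * h.[x.1]) = Num.sg p.[x.1].
  move=> xsp; have [h0|hN0] := eqVneq h.[x.1] 0; first by left.
  right; have [px0|p1] := un x xsp.
    by move: hN0; rewrite hT ?eqxx // /tight px0 eqxx.
  have [pge|plt] := ltP 0 p.[x.1].
    rewrite (gtr0_norm pge) in p1.
    suff ge1 : 1 <= p.[x.1] + t * h.[x.1].
      by rewrite ger0_norm ?gtr0_sg //; lra.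
    have [hge|hlt] := leP 0 h.[x.1]; first by nra.
    have := shrink x xsp; rewrite (ltr0_norm hlt) (gtr0_norm pge).
    have neg : h.[x.1] * p.[x.1] < 0 by nra.
    by move=> /(_ neg); lra.
  have {}plt : p.[x.1] < 0.
    rewrite lt_neqAle plt andbT; apply: contraTneq p1 => ->.
    by rewrite normr0 -ltNge ltr01.
  rewrite (ltr0_norm plt) in p1.
  suff ge1 : p.[x.1] + t * h.[x.1] <= -1.
    by rewrite ltr0_norm ?ltr0_sg //; lra.
  have [hge|hlt] := leP h.[x.1] 0; first by nra.
  have := shrink x xsp; rewrite (gtr0_norm hlt) (ltr0_norm plt).
  have neg : h.[x.1] * p.[x.1] < 0 by nra.
  by move=> /(_ neg); lra.
exists t => q; split.
- move=> x xsp; rewrite qE; have [h0|[ge1 _]] := fate x xsp.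
    by rewrite h0 mulr0 addr0; apply: un.
  by right.
- move=> x xsp; rewrite qE; have [h0|[_ ->]//] := fate x xsp.
  by rewrite h0 mulr0 addr0.
- by move=> x xsp px; rewrite /tight qE (hT x xsp px) mulr0 addr0.
exists x1; split=> //.
  apply: contraTN neg1 => /(hT x1 x1sp) ->; by rewrite mul0r ltxx.
rewrite /tight qE.
have e1 : t * `|h.[x1.1]| = `|p.[x1.1]| - 1 by rewrite divfK // gt_eqF ?hn0.
have [pge|plt] := ltP 0 p.[x1.1].
  have hlt : h.[x1.1] < 0 by nra.
  rewrite (ltr0_norm hlt) (gtr0_norm pge) in e1.
  by have -> : p.[x1.1] + t * h.[x1.1] = 1 by [lra]; rewrite normr1 eqxx orbT.
have hgt : 0 < h.[x1.1] by nra.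
rewrite (gtr0_norm hgt) (ler0_norm plt) in e1.
have -> : p.[x1.1] + t * h.[x1.1] = -1 by lra.
by rewrite normrN1 eqxx orbT.
Qed.

(** As long as rigidity fails, the direction witnessing the failure permits another tightening, and
    fewer nodes remain that are not tight. *)
Lemma rigid_exists p :
  (size p <= k.+1)%N -> wsum p = 0 ->
  exists q, [/\ (size q <= k.+1)%N, wsum q = 0, unit_normal q,
    {in sp, forall x, Num.sg q.[x.1] = Num.sg p.[x.1]} & rigid q].
Proof.
move=> szp Lp; have [c c_gt0 unc] := unit_normal_exists p.
have [N] := ubnP (size sp - count (fun x => tight (c *: p) x.1) sp)%N.
have: (size (c *: p) <= k.+1)%N by apply: leq_trans (size_scale_leq _ _) szp.
have: wsum (c *: p) = 0 by rewrite wsumZ Lp mulr0.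
have: {in sp, forall x, Num.sg (c *: p).[x.1] = Num.sg p.[x.1]}.
  by move=> x _; rewrite hornerZ sgrM gtr0_sg // mul1r.
move: (c *: p) unc => q.
elim: N q => [//|N IH] q un sg_q Lq szq ltN.
have [rq|] := EM (rigid q); first by exists q.
move=> /existsNP[h /not_implyP[szh /not_implyP[Lh /not_implyP[hT]]]].
move=> /existsNP[x0 /not_implyP[x0sp /eqP hx0]].
(* Zeros of [q] are tight, so [h] can be nonzero only where [q] is; hence [h] or [-h] pulls the
   value at [x0] towards [0]. *)
wlog neg0 : h szh Lh hT hx0 / h.[x0.1] * q.[x0.1] < 0.
  have qx0 : q.[x0.1] != 0.
    by apply: contraNneq hx0 => qx0; rewrite hT // /tight qx0 eqxx.
  have [neg|pos|/eqP] := ltgtP (h.[x0.1] * q.[x0.1]) 0.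
  - by move=> /(_ h); apply.
  - move=> /(_ (- h)); apply; rewrite ?size_polyN ?hornerN ?oppr_eq0 //.
    + by rewrite -scaleN1r wsumZ Lh mulr0.
    + by move=> x xsp tx; rewrite hornerN hT ?oppr0.
    + by rewrite mulNr oppr_lt0.
  - by rewrite mulf_eq0 (negPf hx0) (negPf qx0).
have [t [un' sg' sub [x [xsp ntx tx]]]] := unit_normal_tighten un hT x0sp neg0.
apply: (IH (q + t *: h)) => //.
- by move=> y ysp; rewrite sg' ?sg_q.
- by rewrite wsumD wsumZ Lq Lh mulr0 addr0.
- rewrite (leq_trans (size_polyD _ _)) // geq_max szq.
  by rewrite (leq_trans (size_scale_leq _ _)).
suff lt_count : (count (fun x => tight q x.1) sp <
                 count (fun x => tight (q + t *: h) x.1) sp)%N.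
  have := count_size (fun x => tight (q + t *: h) x.1) sp.
  by move: ltN lt_count; lia.
rewrite !(permP (perm_to_rem xsp)) /= (negPf ntx) tx add0n ltnS.
have le_in (s : seq (R * R)) : {subset s <= sp} ->
  (count (fun x => tight q x.1) s <= count (fun x => tight (q + t *: h) x.1) s)%N.
  elim: s => //= y s IHs subs; apply: leq_add.
    by have /sub := subs y (mem_head _ _); case: (tight q y.1) => // ->.
  by apply: IHs => z zs; apply: subs; rewrite inE zs orbT.
by apply: le_in => y /mem_rem.
Qed.

End Rigid.
End WeightedSum.

(** * Newton candidates *)

Section Newton.
Variables (R : realType) (sp : seq (R * R)) (k : nat).
Implicit Types (p q r h w : {poly R}) (I J : seq R).
Notation wsum := (wsum sp).
Notation wI I := (\prod_(x <- I) ('X - x%:P)).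

(** Adding a multiple of [w] keeps the values at the roots of [w], which are the earlier nodes. A
    repeated node gives [w.[x] = 0] and the quotient [0], so the search may allow repetitions. *)
Definition newton p w (x e : R) : {poly R} :=
  p + ((e - p.[x]) / w.[x]) *: w.

(* The truncation is vacuous for the relevant [w]; it keeps the polynomials
   within [k.+1] coefficients unconditionally. *)
Definition add_root w (x : R) : {poly R} :=
  take_poly k.+1 (w * ('X - x%:P)).

Definition balance p w : {poly R} := p + (- (wsum p / wsum w)) *: w.

(* The polynomials tried by the search with [j] interpolation nodes left. *)
Fixpoint candidate j p w q : Prop :=
  (wsum w != 0 /\ q = balance p w) \/
  (if j is j'.+1 then
     exists x e, [/\ x \in sp, e \in [:: 0; 1; -1]
       & candidate j' (newton p w x.1 e) (add_root w x.1) q]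
   else False).

Lemma candidate_leq i j p w q :
  (i <= j)%N -> candidate i p w q -> candidate j p w q.
Proof.
elim: i j p w => [|i IH] [|j] p w //= le_ij [bal|]; try by left.
by move=> [x [e [xsp eb c]]]; right; exists x, e; split=> //; apply: IH c.
Qed.

Lemma wsum_balance p w : wsum w != 0 -> wsum (balance p w) = 0.
Proof. by move=> w0; rewrite wsumD wsumZ mulNr divfK // subrr. Qed.

Lemma size_balance p w :
  (size p <= k.+1)%N -> (size w <= k.+1)%N -> (size (balance p w) <= k.+1)%N.
Proof.
move=> szp szw; rewrite (leq_trans (size_polyD _ _)) // geq_max szp.
exact: leq_trans (size_scale_leq _ _) szw.
Qed.

Lemma tight_sign p x : tight p x -> p.[x] \in [:: 0; 1; -1].
Proof.
by rewrite /tight !inE eqr_norml ler01 andbT.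
Qed.

(** [J] holds the nodes already used and [I] those still to come. Some branch of the search guesses
    every value correctly, because tight values lie in [[:: 0; 1; -1]]. *)
Lemma candidate_interpolation q I J p :
  uniq (I ++ J) -> {subset I <= unzip1 sp} -> all (tight q) I ->
  (size (I ++ J) <= k)%N -> (size p <= k.+1)%N ->
  {in J, forall x, p.[x] = q.[x]} ->
  wsum (wI (I ++ J)) != 0 ->
  exists r, [/\ candidate (size I) p (wI J) r, (size r <= k.+1)%N, wsum r = 0
    & {in I ++ J, forall x, r.[x] = q.[x]}].
Proof.
elim: I J p => [|x I IH] J p /=.
  move=> _ _ _ szJ szp pJ w0; exists (balance p (wI J)); split.
  - by left.
  - by rewrite size_balance // size_prod_XsubC ltnS.
  - exact: wsum_balance.
  - move=> y yJ; rewrite hornerD hornerZ.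
    by have /rootP -> : root (wI J) y; rewrite ?root_prod_XsubC // mulr0 addr0 pJ.
rewrite mem_cat negb_or => /andP[/andP[xI xJ] uIJ] subI /andP[tx tI] szIJ szp pJ.
have wx0 : (wI J).[x] != 0 by rewrite -rootE root_prod_XsubC.
have perm_xJ : perm_eq (I ++ x :: J) (x :: I ++ J).
  by rewrite -cat1s perm_catCA.
rewrite -(perm_big _ perm_xJ) /= => w0.
have [y ysp yx] : exists2 y, y \in sp & y.1 = x.
  by have /subI/mapP[y ysp ->] := mem_head x I; exists y.
have szw : (size (wI (x :: J)) <= k.+1)%N.
  rewrite size_prod_XsubC ltnS (leq_trans _ szIJ) // size_cat.
  by rewrite /=; lia.
have add_xJ : add_root (wI J) x = wI (x :: J).
  rewrite /add_root mulrC.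
  have -> : ('X - x%:P) * wI J = wI (x :: J) by rewrite big_cons.
  by rewrite take_poly_id.
have [||||||r [c szr Lr rE]] := IH (x :: J) (newton p (wI J) x q.[x]) _ _ _ _ _ _ w0.
- by rewrite (perm_uniq perm_xJ) /= mem_cat negb_or xI xJ.
- by move=> z zI; apply: subI; rewrite inE zI orbT.
- by [].
- by rewrite (perm_size perm_xJ).
- rewrite (leq_trans (size_polyD _ _)) // geq_max szp.
  rewrite (leq_trans (size_scale_leq _ _)) // size_prod_XsubC.
  by move: szIJ; rewrite size_cat; lia.
- move=> z; rewrite hornerD hornerZ inE => /predU1P[->|zJ].
    by rewrite divfK // addrC subrK.
  by have /rootP -> : root (wI J) z; rewrite ?root_prod_XsubC // mulr0 addr0 pJ.
exists r; split=> //.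
- right; exists y, q.[x]; split=> //; first exact: tight_sign.
  by rewrite yx add_xJ.
- by move=> z zIJ; apply: rE; rewrite (perm_mem perm_xJ).
Qed.

(** Greedy: nodes are added to the empty set, whose node polynomial is [1], as long as [wsum] stays
    nonzero. *)
Lemma maximal_nodes (T : seq R) :
  wsum 1 != 0 ->
  exists I, [/\ uniq I, {subset I <= T}, (size I <= k)%N, wsum (wI I) != 0
    & (size I < k)%N ->
      {in T, forall t, t \notin I -> wsum (wI I * ('X - t%:P)) = 0}].
Proof.
move=> L1.
have: exists I, [/\ uniq I, {subset I <= T}, (size I <= k)%N & wsum (wI I) != 0].
  by exists [::]; split=> //; rewrite big_nil.
move=> [I]; have [N] := ubnP (k - size I)%N.
elim: N I => [//|N IH] I ltN [uI subI szI LI].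
have [/andP[ltk /hasP[t tT /andP[tI Lt]]]|NI] := boolP ((size I < k)%N &&
  has (fun t => (t \notin I) && (wsum (wI I * ('X - t%:P)) != 0)) T).
  apply: (IH (t :: I)); first by rewrite /=; lia.
  split=> //; first by rewrite /= tI.
  - by move=> z; rewrite inE => /predU1P[->|/subI].
  - by rewrite big_cons mulrC.
exists I; split=> // ltk t tT tI.
move: NI; rewrite ltk /= => /hasPn/(_ t tT); rewrite tI /= negbK.
by move/eqP.
Qed.

Hypothesis weights_gt0 : {in sp, forall x : R * R, 0 < x.2}.

Lemma rigid_interpolation q r I :
  rigid sp k q -> (size q <= k.+1)%N -> wsum q = 0 ->
  (size r <= k.+1)%N -> wsum r = 0 -> {in I, forall x, r.[x] = q.[x]} ->
  uniq I -> (size I <= k)%N -> wsum (wI I) != 0 ->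
  ((size I < k)%N -> {in [seq x <- unzip1 sp | tight q x], forall t,
      t \notin I -> wsum (wI I * ('X - t%:P)) = 0}) ->
  {in sp, forall x, r.[x.1] = q.[x.1]}.
Proof.
move=> rq szq Lq szr Lr rI uI szI LI maxI x xsp.
set g := q - r; suff: g.[x.1] = 0.
  by rewrite /g hornerD hornerN => /subr0_eq.
have szg : (size g <= k.+1)%N.
  by rewrite (leq_trans (size_polyD _ _)) // geq_max size_polyN szq.
have Lg : wsum g = 0 by rewrite wsumB Lq Lr subrr.
have gI y : y \in I -> g.[y] = 0.
  by move=> yI; rewrite hornerD hornerN rI // subrr.
have w_mon : wI I \is monic by apply: monic_prod_XsubC.
have wIr y : (wI I).[y] = 0 -> y \in I by move/rootP; rewrite root_prod_XsubC.
move: szI; rewrite leq_eqVlt => /predU1P[szI|ltk]; last first.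
  (* As a function of [t], the [wsum] of [w_I (X - t)] is affine with nonzero slope, and [c] is its
     only zero. *)
  pose c := wsum (wI I * 'X) / wsum (wI I).
  have Lt t : wsum (wI I * ('X - t%:P)) = wsum (wI I * 'X) - t * wsum (wI I).
    by rewrite mulrBr wsumB [_ * t%:P]mulrC mul_polyC wsumZ.
  have hN y : y \in sp -> (wI I * ('X - c%:P)).[y.1] = 0.
    apply: rq => {y}.
    - rewrite (leq_trans (size_polyMleq _ _)) // size_prod_XsubC size_XsubC.
      by rewrite addn2 /= ltnS.
    - by rewrite Lt divfK // subrr.
    - move=> y ysp ty; have [yI|yI] := boolP (y.1 \in I).
        by rewrite hornerM; have /rootP -> : root (wI I) y.1;
           rewrite ?root_prod_XsubC // mul0r.
      have := maxI ltk y.1; rewrite mem_filter ty map_f //= => /(_ isT yI).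
      rewrite Lt => /subr0_eq e; rewrite /c e mulfK //.
      by rewrite hornerM hornerXsubC subrr mulr0.
  have gc y : y \in sp -> y.1 != c -> g.[y.1] = 0.
    move=> ysp yc; have /eqP := hN y ysp; rewrite hornerM mulf_eq0.
    rewrite hornerXsubC subr_eq0 (negPf yc) orbF => /eqP/wIr; exact: gI.
  have [xc|] := eqVneq x.1 c; last exact: gc.
  (* Only entries at [c] can contribute to [wsum g]. *)
  have : g.[c] * \sum_(y <- sp | y.1 == c) y.2 = 0.
    rewrite -[RHS]Lg mulr_sumr big_mkcond /wsum big_seq [RHS]big_seq.
    apply: eq_bigr => y ysp; case: eqVneq => [->|yc]; first by rewrite mulrC.
    by rewrite gc ?mulr0.
  move/eqP; rewrite mulf_eq0 xc => /orP[/eqP//|].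
  rewrite gt_eqF // (big_rem x xsp) /= xc eqxx ltr_wpDr ?weights_gt0 //.
  rewrite big_seq_cond sumr_ge0 // => y /andP[/mem_rem ysp _].
  exact/ltW/weights_gt0.
have szw : size (wI I) = k.+1 by rewrite size_prod_XsubC szI.
(* [wI I] is monic of degree [k], so this difference has degree below [k] and [k] distinct roots. *)
have g_eq : g - g`_k *: wI I = 0.
  apply: (@roots_geq_poly_eq0 _ _ I) => //; last first.
    rewrite szI; apply/leq_sizeP => j; rewrite leq_eqVlt coefB coefZ.
    move=> /predU1P[<-|ltj].
      by move/monicP: w_mon; rewrite /lead_coef szw /= => ->; rewrite mulr1 subrr.
    by rewrite (leq_sizeP _ _ szg j) // (leq_sizeP _ _ (eq_leq szw) j) // mulr0 subr0.
  apply/allP => y yI; rewrite rootE hornerD hornerN hornerZ gI // sub0r.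
  by have /rootP -> : root (wI I) y; rewrite ?root_prod_XsubC // mulr0 oppr0.
move/subr0_eq: g_eq => g_eq; have := Lg.
rewrite g_eq wsumZ => /eqP; rewrite mulf_eq0 (negPf LI) orbF => /eqP ->.
by rewrite scale0r horner0.
Qed.

Lemma candidate_complete q :
  (size q <= k.+1)%N -> wsum q = 0 -> 0 < wpos sp q ->
  exists2 r, candidate k 0 1 r &
    {in sp, forall x, Num.sg r.[x.1] = Num.sg q.[x.1]}.
Proof.
move=> szq Lq pos_q.
(* The total weight is at least the weight of the nodes where [q] is positive. *)
have L1 : wsum 1 != 0.
  rewrite gt_eqF // (lt_le_trans pos_q) // /wpos big_mkcond /wsum.
  rewrite big_seq [leRHS]big_seq ler_sum // => x xsp.
  by rewrite hornerC mulr1; case: ifP => // _; apply/ltW/weights_gt0.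
have [q' [szq' Lq' unq' sg_q' rq']] := rigid_exists szq Lq.
have [I [uI subI szI LI maxI]] := maximal_nodes [seq x <- unzip1 sp | tight q' x] L1.
have [|||||||r [c szr Lr rE]] := @candidate_interpolation q' I [::] 0 _ _ _ _ _ _ _;
  rewrite ?cats0 ?size_poly0 //.
- by move=> x /subI; rewrite mem_filter => /andP[].
- by apply/allP => x /subI; rewrite mem_filter => /andP[].
exists r; first by rewrite big_nil in c; apply: candidate_leq c.
move=> x xsp; rewrite -sg_q' //; congr (Num.sg _).
apply: (rigid_interpolation rq' szq' Lq' szr Lr _ uI szI LI maxI) => // y yI.
by apply: rE; rewrite cats0.
Qed.

End Newton.

(** * A structured language and its compilation *)

(** A row and a column, so that one row can store the coefficients of one polynomial; [pickle] turns
    the pair into an address. *)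
Definition loc := (nat * nat)%type.

(** The only loop visits the entries of the spectrum and loads node and weight into two locations.
    Programs therefore always terminate, in a time that is bounded from their text. *)
Inductive code :=
  | CSkip
  | CLit of loc & nat
  | CMov of loc & loc
  | COp of rop & loc & loc & loc
  | CSeq of code & code
  | CIf of loc & loc & code & code
  | CFor of loc & loc & code.

Fixpoint loc_bound (c : code) : nat :=
  match c with
  | CSkip => 0
  | CLit a _ => (pickle a).+1
  | CMov a b => maxn (pickle a).+1 (pickle b).+1
  | COp _ a b l => maxn (pickle a).+1 (maxn (pickle b).+1 (pickle l).+1)
  | CSeq c1 c2 => maxn (loc_bound c1) (loc_bound c2)
  | CIf a b c1 c2 => maxn (maxn (pickle a).+1 (pickle b).+1)
                          (maxn (loc_bound c1) (loc_bound c2))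
  | CFor a b c => maxn (maxn (pickle a).+1 (pickle b).+1) (loc_bound c)
  end.

(** A division compiles to at most two tests and one instruction, hence the [3]. Besides its body, a
    loop spends one test and four instructions per entry, plus an initialization and a final failing
    test. *)
Fixpoint cost (N : nat) (c : code) : nat :=
  match c with
  | CSkip | CLit _ _ | CMov _ _ => 1
  | COp _ _ _ _ => 3
  | CSeq c1 c2 => cost N c1 + cost N c2
  | CIf _ _ c1 c2 => (cost N c1 + cost N c2).+1
  | CFor _ _ c => N * (cost N c + 5) + 2
  end.

(** The [7] absorbs both loop overheads [5] and [2] of [cost]. *)
Fixpoint code_size (c : code) : nat :=
  match c with
  | CSkip | CLit _ _ | CMov _ _ => 1
  | COp _ _ _ _ => 3
  | CSeq c1 c2 => code_size c1 + code_size c2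
  | CIf _ _ c1 c2 => (code_size c1 + code_size c2).+1
  | CFor _ _ c => code_size c + 7
  end.

Fixpoint loop_depth (c : code) : nat :=
  match c with
  | CSkip | CLit _ _ | CMov _ _ | COp _ _ _ _ => 0
  | CSeq c1 c2 | CIf _ _ c1 c2 => maxn (loop_depth c1) (loop_depth c2)
  | CFor _ _ c => (loop_depth c).+1
  end.

Lemma cost_bound N c : (cost N c <= code_size c * N.+1 ^ loop_depth c)%N.
Proof.
have grow i m n : (i <= m * N.+1 ^ n -> forall n', n <= n' -> i <= m * N.+1 ^ n')%N.
  move=> lei n' len; apply: leq_trans lei _.
  by rewrite leq_mul2l leq_pexp2l ?orbT.
elim: c => [|l v|a b|o a b l|c1 IH1 c2 IH2|a b c1 IH1 c2 IH2|a b c IH] /=;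
  rewrite ?expn0 ?muln1 //.
- by rewrite mulnDl leq_add // (grow _ _ _ IH1, grow _ _ _ IH2) ?leq_maxl ?leq_maxr.
- rewrite -addn1 -[X in (X * _)%N]addn1 !mulnDl mul1n.
  rewrite !leq_add ?expn_gt0 //.
    by rewrite (grow _ _ _ IH1) ?leq_maxl.
  by rewrite (grow _ _ _ IH2) ?leq_maxr.
have : (0 < N.+1 ^ loop_depth c)%N by rewrite expn_gt0.
rewrite expnS; move: IH; move: (cost N c) (code_size c) (_ ^ _)%N => x y z.
by move=> lex z_gt0; nia.
Qed.

Section Compilation.
Variable M : nat.

(** After the three reserved registers come [M] registers for locations, then one loop pointer for
    each nesting depth. *)
Definition lreg (l : loc) : nat := 3 + pickle l.
Definition ptr (d : nat) : nat := 3 + M + d.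

(* Register 0 holds the end of the input, register 1 the constant 1, and
   register 2 the address of a cell containing 0.  [COp RDiv] is made total,
   with [x / 0 = 0]. *)
Fixpoint compile (d : nat) (c : code) : cmd :=
  match c with
  | CSkip => Skip
  | CLit l v => RLit (lreg l) v
  | CMov a b => RMov (lreg a) (lreg b)
  | COp RDiv a b l =>
      If (RLt 2 (lreg l)) (ROp RDiv (lreg a) (lreg b) (lreg l))
        (If (RLt (lreg l) 2) (ROp RDiv (lreg a) (lreg b) (lreg l))
           (RMov (lreg a) 2))
  | COp o a b l => ROp o (lreg a) (lreg b) (lreg l)
  | CSeq c1 c2 => Seq (compile d c1) (compile d c2)
  | CIf a b c1 c2 => If (RLt (lreg a) (lreg b)) (compile d c1) (compile d c2)
  | CFor a b c =>
      Seq (ILit (ptr d) 0)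
        (While (ILt (ptr d) 0)
           (Seq (RMov (lreg a) (ptr d))
           (Seq (IOp IAdd (ptr d) (ptr d) 1)
           (Seq (RMov (lreg b) (ptr d))
           (Seq (IOp IAdd (ptr d) (ptr d) 1) (compile d.+1 c))))))
  end.

Variables (R : realType) (sp : seq (R * R)).
Implicit Types (V : loc -> R) (s : state R).

Definition setv V (l : loc) (x : R) : loc -> R :=
  fun a => if a == l then x else V a.

Fixpoint run (c : code) V : loc -> R :=
  match c with
  | CSkip => V
  | CLit l v => setv V l v%:R
  | CMov a b => setv V a (V b)
  | COp o a b l => setv V a (rop_eval o (V b) (V l))
  | CSeq c1 c2 => run c2 (run c1 V)
  | CIf a b c1 c2 => if V a < V b then run c1 V else run c2 V
  | CFor a b c =>
      foldl (fun V x => run c (setv (setv V a x.1) b x.2)) V sp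
  end.

Variable base : nat.

(** Each location register holds one fixed address throughout, which makes indirect addressing
    static. The shift by one leaves the cell [base] for the constant [0]. *)
Record represents V s : Prop := Represents {
  rep_end : ireg s 0%N = (size sp).*2;
  rep_one : ireg s 1%N = 1%N;
  rep_zero : ireg s 2%N = base;
  rep_zero_cell : rmem s base = 0;
  rep_reg : forall l, (pickle l < M)%N -> ireg s (lreg l) = (base + (pickle l).+1)%N;
  rep_loc : forall l, (pickle l < M)%N -> rmem s (base + (pickle l).+1)%N = V l;
  rep_node : forall i, (i < size sp)%N -> rmem s i.*2 = (nth (0, 0) sp i).1;
  rep_weight : forall i, (i < size sp)%N -> rmem s i.*2.+1 = (nth (0, 0) sp i).2
}.

Hypothesis base_ge : ((size sp).*2 <= base)%N.

Lemma rep_cell V s l : represents V s -> (pickle l < M)%N -> cell s (lreg l) = V l.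
Proof. by move=> rs lM; rewrite /cell (rep_reg rs) ?(rep_loc rs). Qed.

Lemma rep_cell0 V s : represents V s -> cell s 2 = 0.
Proof. by move=> rs; rewrite /cell (rep_zero rs) (rep_zero_cell rs). Qed.

Lemma rep_set V s l x : represents V s -> (pickle l < M)%N ->
  represents (setv V l x) (set_cell s (lreg l) x).
Proof.
move=> rs lM; case: (rs) => r0 r1 r2 rz rr rl rn rw.
have far a : (a <= base)%N -> upd (rmem s) (ireg s (lreg l)) x a = rmem s a.
  by move=> le_a; rewrite /upd rr // ltn_eqF // addnS ltnS (leq_trans le_a) ?leq_addr.
split=> //=; try by rewrite far.
- move=> a aM; rewrite /upd rr // eqn_add2l eqSS /setv.
  by rewrite (inj_eq (pcan_inj pickleK)) rl.
- by move=> i lti; rewrite far ?rn //; move: base_ge; lia.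
- by move=> i lti; rewrite far ?rw //; move: base_ge; lia.
Qed.

Lemma rep_set_ptr V s d v : represents V s -> represents V (set_ireg s (ptr d) v).
Proof.
case=> r0 r1 r2 rz rr rl rn rw; split=> //=; rewrite /upd /ptr //.
move=> l lM; rewrite rr // ltn_eqF //.
by rewrite /lreg; lia.
Qed.

(** Code compiled at depth [d] must not move the pointers of the enclosing loops. *)
Definition keeps_ptrs d s s' := forall e, (e < d)%N -> ireg s' (ptr e) = ireg s (ptr e).

(** Stated for a loop resumed at entry [i], stored in cells [i.*2] and [i.*2.+1], to allow induction
    on the number of remaining entries. *)
Lemma exec_loop d a b c T :
  (pickle a < M)%N -> (pickle b < M)%N ->
  (forall s V, represents V s -> exists t s',
     [/\ exec (compile d.+1 c) s t s', (t <= T)%N, represents (run c V) s'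
       & keeps_ptrs d.+1 s s']) ->
  forall (i : nat) s V, represents V s -> ireg s (ptr d) = i.*2 -> exists t s',
    [/\ exec (While (ILt (ptr d) 0)
           (Seq (RMov (lreg a) (ptr d))
           (Seq (IOp IAdd (ptr d) (ptr d) 1)
           (Seq (RMov (lreg b) (ptr d))
           (Seq (IOp IAdd (ptr d) (ptr d) 1) (compile d.+1 c)))))) s t s',
        (t <= (size sp - i) * (T + 5) + 1)%N,
        represents (foldl (fun V x => run c (setv (setv V a x.1) b x.2)) V
                      (drop i sp)) s'
      & keeps_ptrs d s s'].
Proof.
move=> aM bM body i; move En: (size sp - i)%N => n.
elim: n i En => [|n IH] i En s V rs ptr_s.
  exists 1%N, s; split=> //.
    by apply: exec_WhileF; rewrite /= ptr_s (rep_end rs) ltn_double -leqNgt; lia.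
  by rewrite drop_oversize //; lia.
have lt_i : (i < size sp)%N by lia.
pose x := nth (0, 0) sp i.
have ptr1 u : ireg (set_ireg u (ptr d) (ireg u (ptr d) + ireg u 1)%N) (ptr d) =
  (ireg u (ptr d) + ireg u 1)%N :> nat by move=> *; rewrite /= /upd eqxx.
pose s1 := set_cell s (lreg a) (cell s (ptr d)).
pose s2 := set_ireg s1 (ptr d) (iop_eval IAdd (ireg s1 (ptr d)) (ireg s1 1%N)).
pose s3 := set_cell s2 (lreg b) (cell s2 (ptr d)).
pose s4 := set_ireg s3 (ptr d) (iop_eval IAdd (ireg s3 (ptr d)) (ireg s3 1%N)).
have c1 : cell s (ptr d) = x.1 by rewrite /cell ptr_s (rep_node rs).
have rs1 : represents (setv V a x.1) s1 by rewrite /s1 c1; apply: rep_set.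
have p1 : ireg s1 (ptr d) = i.*2 by [].
have rs2 : represents (setv V a x.1) s2 by apply: rep_set_ptr.
have p2 : ireg s2 (ptr d) = i.*2.+1.
  by rewrite /s2 ptr1 p1 (rep_one rs1) addn1.
have c2 : cell s2 (ptr d) = x.2 by rewrite /cell p2 (rep_weight rs2).
have rs3 : represents (setv (setv V a x.1) b x.2) s3.
  by rewrite /s3 c2; apply: rep_set.
have p3 : ireg s3 (ptr d) = i.*2.+1 by [].
have rs4 : represents (setv (setv V a x.1) b x.2) s4 by apply: rep_set_ptr.
have p4 : ireg s4 (ptr d) = i.+1.*2.
  by rewrite /s4 ptr1 p3 (rep_one rs3) addn1.
have [tb [s5 [ex5 leT rs5 k5]]] := body _ _ rs4.
have [||tl [s6 [ex6 le6 rs6 k6]]] := IH i.+1 _ _ _ rs5 _.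
- by lia.
- by rewrite k5.
exists (1 + (1 + (1 + (1 + tb))) + tl)%N.+1, s6; split.
- apply: exec_WhileT ex6; first by rewrite /= ptr_s (rep_end rs) ltn_double.
  do 4![apply: exec_Seq; first by constructor].
  exact: ex5.
- by move: le6 leT; nia.
- by rewrite (drop_nth (0, 0) lt_i).
- move=> e lt_e; rewrite k6 // k5 1?ltnW //.
  by rewrite /s4 /s3 /s2 /s1 /= /upd /ptr eqn_add2l (ltn_eqF lt_e).
Qed.

Lemma compile_correct c d s V :
  (loc_bound c <= M)%N -> represents V s -> exists t s',
    [/\ exec (compile d c) s t s', (t <= cost (size sp) c)%N,
        represents (run c V) s' & keeps_ptrs d s s'].
Proof.
elim: c d s V => [|l v|a b|o a b l|c1 IH1 c2 IH2|a b c1 IH1 c2 IH2|a b c IH] d s V /=.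
- by move=> _ rs; exists 1%N, s; split=> //; constructor.
- move=> lM rs; exists 1%N, (set_cell s (lreg l) v%:R); split=> //.
    by constructor.
  exact: rep_set.
- rewrite geq_max => /andP[aM bM] rs.
  exists 1%N, (set_cell s (lreg a) (cell s (lreg b))); split=> //.
    by constructor.
  by rewrite (rep_cell rs) //; apply: rep_set.
- rewrite !geq_max => /and3P[aM bM lM] rs.
  have [o_div|o_total] : o = RDiv \/ (forall y, @rop_defined R o y).
    by case: o; [right|right|right|left].
  + subst o; set s' := set_cell s (lreg a) (V b / V l).
    have rs' : represents (setv V a (V b / V l)) s' by apply: rep_set.
    have ex_div : V l != 0 -> exec (ROp RDiv (lreg a) (lreg b) (lreg l)) s 1 s'.
      move=> l0; rewrite /s' -(rep_cell rs bM) -(rep_cell rs lM).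
      by apply: (@exec_ROp _ s RDiv); rewrite /= (rep_cell rs lM).
    have [l0|l0|l0] := ltgtP (V l) 0.
    * exists 3%N, s'; split=> //; apply: exec_IfF.
        by rewrite /= (rep_cell0 rs) (rep_cell rs) // -leNgt ltW.
      apply: exec_IfT; first by rewrite /= (rep_cell0 rs) (rep_cell rs).
      by apply: ex_div; rewrite lt_eqF.
    * exists 2%N, s'; split=> //; apply: exec_IfT.
        by rewrite /= (rep_cell0 rs) (rep_cell rs).
      by apply: ex_div; rewrite gt_eqF.
    * exists 3%N, s'; split=> //; apply: exec_IfF.
        by rewrite /= (rep_cell0 rs) (rep_cell rs) // l0 ltxx.
      apply: exec_IfF; first by rewrite /= (rep_cell0 rs) (rep_cell rs) // l0 ltxx.
      rewrite /s' l0 invr0 mulr0 -(rep_cell0 rs); by constructor.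
  + have -> : (match o with
       | RDiv => If (RLt 2 (lreg l)) (ROp RDiv (lreg a) (lreg b) (lreg l))
        (If (RLt (lreg l) 2) (ROp RDiv (lreg a) (lreg b) (lreg l))
           (RMov (lreg a) 2)) | _ => ROp o (lreg a) (lreg b) (lreg l) end)
       = ROp o (lreg a) (lreg b) (lreg l).
      by case: o o_total => // /(_ 0); rewrite /= eqxx.
    exists 1%N, (set_cell s (lreg a) (rop_eval o (V b) (V l))); split=> //.
      by rewrite -(rep_cell rs bM) -(rep_cell rs lM); constructor.
    exact: rep_set.
- rewrite geq_max => /andP[M1 M2] rs.
  have [t1 [s1 [ex1 le1 rs1 k1]]] := IH1 d s V M1 rs.
  have [t2 [s2 [ex2 le2 rs2 k2]]] := IH2 d _ _ M2 rs1.
  exists (t1 + t2)%N, s2; split=> //; first exact: exec_Seq ex2.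
    exact: leq_add.
  by move=> e lt_e; rewrite k2 ?k1.
- rewrite !geq_max => /andP[/andP[aM bM] /andP[M1 M2]] rs.
  have [ab|ab] := boolP (V a < V b).
    have [t1 [s1 [ex1 le1 rs1 k1]]] := IH1 d s V M1 rs.
    exists t1.+1, s1; split=> //; last by lia.
    by apply: exec_IfT; rewrite //= (rep_cell rs) // (rep_cell rs).
  have [t2 [s2 [ex2 le2 rs2 k2]]] := IH2 d s V M2 rs.
  exists t2.+1, s2; split=> //; last by lia.
  by apply: exec_IfF; rewrite //= (rep_cell rs) // (rep_cell rs).
rewrite !geq_max => /andP[/andP[aM bM] cM] rs.
have [|t [s' [ex le_t rs' k']]] := exec_loop aM bM
  (fun s V => IH d.+1 s V cM) (i := 0) (rep_set_ptr d 0 rs) _.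
  by rewrite /= /upd eqxx.
exists (1 + t)%N, s'; split.
- by apply: exec_Seq ex; constructor.
- by move: le_t; rewrite subn0; lia.
- by rewrite drop0 in rs'.
- by move=> e lt_e; rewrite k' //= /upd /ptr eqn_add2l (ltn_eqF lt_e).
Qed.

End Compilation.

(** * The search program *)

Definition cseq : seq code -> code := foldr CSeq CSkip.

Fixpoint horner_code (r x : loc) (row i n : nat) : code :=
  if n is n'.+1 then
    cseq [:: horner_code r x row i.+1 n'; COp RMul r r x; COp RAdd r r (row, i)]
  else CLit r 0.

(* Row 0 holds the scalars, row 1 the best polynomial found so far and row 2
   the current candidate. Rows [prow l] and [wrow l] hold the interpolant of
   [l] nodes and its node polynomial. *)
Local Notation th := (0, 0)%N.
Local Notation mu := (0, 1)%N.
Local Notation ev := (0, 2)%N.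
Local Notation Lp := (0, 3)%N.
Local Notation Lw := (0, 4)%N.
Local Notation cf := (0, 5)%N.
Local Notation np := (0, 6)%N.
Local Notation nn := (0, 7)%N.
Local Notation best := (0, 8)%N.
Local Notation rat := (0, 9)%N.
Local Notation zr := (0, 10)%N.
Local Notation ep := (0, 11)%N.
Local Notation un := (0, 12)%N.
Local Notation prow l := (l.*2.+3).
Local Notation wrow l := (l.*2.+4).

Section Programs.
Variable k : nat.

(* [locked] stops the equations of [run] from unfolding these subprograms. *)
Definition eval_code (r x : loc) (row : nat) : code :=
  locked (horner_code r x row 0 k.+1).

Definition row_code (f : nat -> code) : code :=
  locked (cseq [seq f i | i <- iota 0 k.+1]).

Definition axpy_code (row' row : nat) (c : loc) (wr : nat) : code :=
  row_code (fun i => CSeq (COp RMul (row', i) c (wr, i))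
                          (COp RAdd (row', i) (row, i) (row', i))).

(** Multiplication by [X] shifts the coefficients; [zr], set to [0] by the caller, stands for the
    missing one below the constant term. *)
Definition add_root_code (row' row : nat) (x : loc) : code :=
  row_code (fun i => CSeq (COp RMul (row', i) x (row, i))
    (COp RSub (row', i) (if i is i'.+1 then (row, i') else zr) (row', i))).

Definition copy_code (row' row : nat) : code :=
  row_code (fun i => CMov (row', i) (row, i)).

Definition sums_code (P W : nat) : code :=
  cseq [:: CLit Lp 0; CLit Lw 0;
    CFor th mu (cseq [:: eval_code ev th P; COp RMul ev mu ev; COp RAdd Lp Lp ev;
                         eval_code ev th W; COp RMul ev mu ev; COp RAdd Lw Lw ev])].

Definition balance_code (P W : nat) : code :=
  cseq [:: COp RDiv cf Lp Lw; CLit zr 0; COp RSub cf zr cf; axpy_code 2 P cf W].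

Definition count_code : code :=
  cseq [:: CLit np 0; CLit nn 0; CLit zr 0;
    CFor th mu (cseq [:: eval_code ev th 2;
      CIf zr ev (COp RAdd np np mu) (CIf ev zr (COp RAdd nn nn mu) CSkip)])].

(* [un] is the indicator of [Lw != 0]. *)
Definition keep_code : code :=
  cseq [:: COp RDiv un Lw Lw; COp RMul ev np un; COp RDiv rat nn np; CLit zr 0;
    CIf zr ev (CIf best rat (cseq [:: CMov best rat; copy_code 1 2]) CSkip) CSkip].

Definition leaf_code (l : nat) : code :=
  cseq [:: sums_code (prow l) (wrow l); balance_code (prow l) (wrow l);
           count_code; keep_code].

(** Literals are natural numbers, so [-1] is computed as [0 - 1]. *)
Definition sign_codes : seq code :=
  [:: CLit ep 0; CLit ep 1; cseq [:: CLit ep 1; CLit zr 0; COp RSub ep zr ep]].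

(** Column [k.+1] lies just past the coefficients of the row: each level owns a loop variable that
    row operations leave alone. *)
Definition node_loc (l : nat) : loc := (prow l.+1, k.+1).

Definition step_code (l : nat) (ce : code) : code :=
  cseq [:: eval_code ev (node_loc l) (prow l); ce; COp RSub cf ep ev;
    eval_code ev (node_loc l) (wrow l); COp RDiv cf cf ev;
    axpy_code (prow l.+1) (prow l) cf (wrow l);
    CLit zr 0; add_root_code (wrow l.+1) (wrow l) (node_loc l)].

(** The recursion of [candidate] is unrolled into nested loops in the program text, as [k] is fixed;
    [l] is the number of nodes chosen so far. *)
Fixpoint search_code (j l : nat) : code :=
  if j is j'.+1 then
    CSeq (leaf_code l)
      (CFor (node_loc l) mu
         (cseq (flatten [seq [:: step_code l ce; search_code j' l.+1]
                        | ce <- sign_codes])))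
  else leaf_code l.

(** Locations start at [0], so one literal suffices to set up the empty interpolation problem, with
    interpolant [0] and node polynomial [1]. *)
Definition main_code : code :=
  cseq [:: CLit best 1; CLit zr 0; COp RSub best zr best;
           CLit (wrow 0, 0)%N 1; search_code k 0].

(** * Effect of the row operations on polynomials *)

Section Runs.
Variables (R : realType) (sp : seq (R * R)).
Implicit Types (V : loc -> R) (q : {poly R}).
Notation run := (run sp).

Lemma setv_eq V l x : setv V l x l = x.
Proof. by rewrite /setv eqxx. Qed.

Lemma setv_ne V l x a : a != l -> setv V l x a = V a.
Proof. by rewrite /setv => /negPf ->. Qed.

Definition rowpoly V (r : nat) : {poly R} := \poly_(i < k.+1) V (r, i).

Definition setrow V (r n : nat) (g : nat -> R) : loc -> R :=
  fun a => if (a.1 == r) && (a.2 < n)%N then g a.2 else V a.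

Definition agree (S : seq loc) V V' := forall a, a \notin S -> V' a = V a.

Lemma eq_rowpoly V V' r :
  (forall i, (i <= k)%N -> V' (r, i) = V (r, i)) -> rowpoly V' r = rowpoly V r.
Proof. by move=> eqV; apply/polyP => i; rewrite !coef_poly; case: ifP => // /eqV. Qed.

Lemma agree_rowpoly S V V' r : agree S V V' -> all (fun a => a.1 != r) S ->
  rowpoly V' r = rowpoly V r.
Proof.
move=> ag /allP nS; apply: eq_rowpoly => i _; apply: ag.
by apply/negP => /nS; rewrite eqxx.
Qed.

Lemma run_horner r x row i n V : r != x -> r.1 != row ->
  run (horner_code r x row i n) V =
  setv V r (\sum_(j < n) V (row, i + j)%N * V x ^+ j).
Proof.
move=> rx rrow; elim: n i => [|n IH] i /=; first by rewrite big_ord0.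
rewrite IH; apply: funext => a; rewrite /setv eqxx.
case: (a == r) => //.
rewrite [x == r]eq_sym (negPf rx) big_ord_recl addn0 expr0 mulr1 [RHS]addrC.
have -> : ((row, i) == r) = false.
  by apply: contraNF rrow => /eqP <-.
rewrite /=; congr (_ + _); rewrite mulr_suml; apply: eq_bigr => j _ /=.
by rewrite -mulrA -exprSr addSnnS.
Qed.

Lemma run_eval r x row V : r != x -> r.1 != row ->
  run (eval_code r x row) V = setv V r (rowpoly V row).[V x].
Proof. by move=> rx rrow; rewrite /eval_code -lock run_horner // horner_poly. Qed.

Lemma run_cseq cs V : run (cseq cs) V = foldl (fun V c => run c V) V cs.
Proof. by elim: cs V => //= c cs IH V; rewrite IH. Qed.

(** Since [g] reads only outside the row being written, the entries can be computed one after
    another from the initial memory. *)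
Lemma run_row (f : nat -> code) row (g : (loc -> R) -> nat -> R) V :
  (forall V i, run (f i) V = setv V (row, i) (g V i)) ->
  (forall V V' i, (forall a, a.1 != row -> V' a = V a) -> g V' i = g V i) ->
  run (row_code f) V = setrow V row k.+1 (g V).
Proof.
move=> fE gE; rewrite /row_code -lock run_cseq; elim: k.+1 => [|n IH].
  by apply: funext => a; rewrite /setrow ltn0 andbF.
rewrite -addn1 iotaD map_cat foldl_cat IH /= fE.
have -> : g (setrow V row n (g V)) n = g V n.
  by apply: gE => a na; rewrite /setrow (negPf na).
apply: funext => -[r i]; rewrite /setv /setrow /= xpair_eqE addn1 ltnS.
rewrite [(i <= n)%N]leq_eqVlt.
by have [->|] := eqVneq r row; have [->|] := eqVneq i n.
Qed.

Lemma run_axpy row' row c wr V :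
  row' != row -> row' != wr -> row' != c.1 ->
  run (axpy_code row' row c wr) V =
  setrow V row' k.+1 (fun i => V (row, i) + V c * V (wr, i)).
Proof.
move=> nr nw nc; apply: (run_row (g := fun V i => V (row, i) + V c * V (wr, i))).
  move=> U i /=; rewrite /setv eqxx xpair_eqE [row == _]eq_sym (negPf nr) /=.
  by apply: funext => a; case: (a == _).
by move=> U U' i eqU; rewrite !eqU //= eq_sym.
Qed.

Lemma run_add_root row' row x V :
  row' != row -> row' != 0%N -> row' != x.1 ->
  run (add_root_code row' row x) V =
  setrow V row' k.+1
    (fun i => V (if i is i'.+1 then (row, i') else zr) - V x * V (row, i)).
Proof.
move=> nr n0 nx; apply: (run_row
  (g := fun V i => V (if i is i'.+1 then (row, i') else zr) - V x * V (row, i))).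
  move=> U i /=; rewrite /setv eqxx.
  have -> : ((if i is i'.+1 then (row, i') else zr) == (row', i)) = false.
    by case: i => [|i]; rewrite xpair_eqE eq_sym ?(negPf n0, negPf nr).
  by apply: funext => a; case: (a == _).
move=> U U' i eqU; rewrite (eqU x) 1?eq_sym // (eqU (row, i)) 1?eq_sym //.
by congr (_ - _); apply: eqU; case: i => [|i]; rewrite eq_sym.
Qed.

Lemma run_copy row' row V : row' != row ->
  run (copy_code row' row) V = setrow V row' k.+1 (fun i => V (row, i)).
Proof.
move=> nr; apply: (run_row (g := fun V i => V (row, i))) => //.
by move=> U U' i eqU; rewrite eqU //= eq_sym.
Qed.

Lemma rowpoly_setrow V r g : rowpoly (setrow V r k.+1 g) r = \poly_(i < k.+1) g i.
Proof. by apply: eq_poly => i lti; rewrite /setrow /= eqxx lti. Qed.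

Lemma rowpoly_axpy V row wr c :
  \poly_(i < k.+1) (V (row, i) + c * V (wr, i)) = rowpoly V row + c *: rowpoly V wr.
Proof.
apply/polyP => i; rewrite !(coefE, coefZ, coef_poly).
by case: ifP; rewrite ?mulr0 ?addr0.
Qed.

Lemma rowpoly_add_root V row x : V zr = 0 ->
  \poly_(i < k.+1) (V (if i is i'.+1 then (row, i') else zr) - x * V (row, i)) =
  add_root k (rowpoly V row) x.
Proof.
move=> z0; apply/polyP => i; rewrite coef_take_poly coef_poly ltnS.
case: leqP => // lei.
rewrite mulrBr coefB coefMX coefMC !coef_poly !ltnS lei [x * _]mulrC.
by case: i lei => [|i] lei; rewrite /= ?z0 // ltnW.
Qed.

Lemma run_for a b c V :
  run (CFor a b c) V = foldl (fun V x => run c (setv (setv V a x.1) b x.2)) V sp.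
Proof. by []. Qed.

End Runs.
End Programs.

Arguments agree_rowpoly [k R S V V' r].

(** * Specifications of the subprograms and of the search *)

Section Specs.
Variables (k : nat) (R : realType) (sp : seq (R * R)).
Implicit Types (V : loc -> R) (q : {poly R}).
Notation run := (run sp).
Notation rowpoly := (@rowpoly k R).

Lemma run_cons c cs V : run (cseq (c :: cs)) V = run (cseq cs) (run c V).
Proof. by []. Qed.
Lemma run_nil V : run (cseq [::]) V = V.
Proof. by []. Qed.
Lemma run_seq c1 c2 V : run (CSeq c1 c2) V = run c2 (run c1 V).
Proof. by []. Qed.
Lemma run_lit l v V : run (CLit l v) V = setv V l v%:R.
Proof. by []. Qed.
Lemma run_mov a b V : run (CMov a b) V = setv V a (V b).
Proof. by []. Qed.
Lemma run_op o a b l V : run (COp o a b l) V = setv V a (rop_eval o (V b) (V l)).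
Proof. by []. Qed.
Lemma run_if a b c1 c2 V :
  run (CIf a b c1 c2) V = if V a < V b then run c1 V else run c2 V.
Proof. by []. Qed.

Definition runE := (run_cons, run_nil, run_seq, run_lit, run_mov, run_op, run_if).

Lemma rowpoly_setv V l x r : l.1 != r -> rowpoly (setv V l x) r = rowpoly V r.
Proof.
move=> nl; apply: eq_rowpoly => i _; rewrite setv_ne //.
by apply: contraNneq nl => <-.
Qed.

Definition getE := (rowpoly_setv, setv_eq, setv_ne).

Lemma agree_trans S V1 V2 V3 : agree S V1 V2 -> agree S V2 V3 -> agree S V1 V3.
Proof. by move=> a12 a23 a aS; rewrite a23 ?a12. Qed.

Lemma agree_setv S V V' l x : l \in S -> agree S V V' -> agree S V (setv V' l x).
Proof. by move=> lS ag a aS; rewrite setv_ne ?ag //; apply: contraNneq aS => ->. Qed.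

(** The rows are successors because row [0] holds the accumulators, which the loop overwrites. *)
Lemma run_sums P W V : let V' := run (sums_code k P.+1 W.+1) V in
  [/\ V' Lp = wsum sp (rowpoly V P.+1), V' Lw = wsum sp (rowpoly V W.+1)
    & agree [:: th; mu; ev; Lp; Lw] V V'].
Proof.
cbv zeta; rewrite /sums_code !runE run_for /wsum.
set S := (X in agree X); set F := (X in foldl X).
have FE U x : [/\ F U x Lp = U Lp + x.2 * (rowpoly U P.+1).[x.1],
    F U x Lw = U Lw + x.2 * (rowpoly U W.+1).[x.1] & agree S U (F U x)].
  rewrite /F !runE !run_eval // !getE //; split=> //.
  by do !apply: agree_setv.
have loop s U : [/\
    foldl F U s Lp = U Lp + \sum_(x <- s) x.2 * (rowpoly U P.+1).[x.1],
    foldl F U s Lw = U Lw + \sum_(x <- s) x.2 * (rowpoly U W.+1).[x.1]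
    & agree S U (foldl F U s)].
  elim: s U => [|x s IH] U /=; first by rewrite !big_nil !addr0.
  have [e1 e2 ag] := IH (F U x); have [f1 f2 agF] := FE U x.
  rewrite e1 e2 f1 f2 !big_cons !(agree_rowpoly agF) // -!addrA.
  by split=> //; apply: agree_trans agF ag.
have [-> -> ag] := loop sp (setv (setv V Lp 0) Lw 0).
rewrite !getE // !add0r; split=> //.
by apply: agree_trans ag; do !apply: agree_setv.
Qed.

Lemma run_balance P W V : let V' := run (balance_code k P.+3 W.+3) V in
  rowpoly V' 2 = rowpoly V P.+3 + (- (V Lp / V Lw)) *: rowpoly V W.+3 /\
  (forall a, a.1 != 2%N -> a \notin [:: cf; zr] -> V' a = V a).
Proof.
rewrite /balance_code !runE run_axpy //= !getE // sub0r; split.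
  rewrite rowpoly_setrow -rowpoly_axpy; apply: eq_poly => i lti.
  by rewrite !getE.
move=> a a2; rewrite !inE negb_or => /andP[ac az].
by rewrite /setrow (negPf a2) /= !setv_ne.
Qed.

Lemma run_count V : let V' := run (count_code k) V in
  [/\ V' np = wpos sp (rowpoly V 2), V' nn = wneg sp (rowpoly V 2)
    & agree [:: th; mu; ev; np; nn; zr] V V'].
Proof.
cbv zeta; rewrite /count_code !runE run_for /wpos /wneg.
set S := (X in agree X); set F := (X in foldl X).
have FE U x : U zr = 0 -> [/\
    F U x np = U np + (if 0 < (rowpoly U 2).[x.1] then x.2 else 0),
    F U x nn = U nn + (if (rowpoly U 2).[x.1] < 0 then x.2 else 0),
    F U x zr = 0 & agree S U (F U x)].
  move=> z0; rewrite /F !runE !run_eval // !getE // z0 /=.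
  case: ltgtP => _; rewrite !getE // ?z0 ?addr0; split=> //;
    by do !apply: agree_setv.
have loop s U : U zr = 0 -> [/\
    foldl F U s np = U np + \sum_(x <- s | 0 < (rowpoly U 2).[x.1]) x.2,
    foldl F U s nn = U nn + \sum_(x <- s | (rowpoly U 2).[x.1] < 0) x.2
    & agree S U (foldl F U s)].
  elim: s U => [|x s IH] U z0 /=; first by rewrite !big_nil !addr0.
  have [f1 f2 f3 agF] := FE U x z0; have [e1 e2 ag] := IH (F U x) f3.
  rewrite e1 e2 f1 f2 !big_cons !(agree_rowpoly agF) // -!addrA.
  split; try by case: ifP; rewrite ?add0r.
  exact: agree_trans agF ag.
have [|-> -> ag] := loop sp (setv (setv (setv V np 0) nn 0) zr 0).
  by rewrite setv_eq.
rewrite !getE // !add0r; split=> //.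
by apply: agree_trans ag; do !apply: agree_setv.
Qed.

Lemma run_keep V : let V' := run (keep_code k) V in
  (forall a, (1 < a.1)%N -> V' a = V a) /\
  if [&& V Lw != 0, 0 < V np & V best < V nn / V np]
  then V' best = V nn / V np /\ rowpoly V' 1 = rowpoly V 2
  else V' best = V best /\ rowpoly V' 1 = rowpoly V 1.
Proof.
rewrite /keep_code !runE run_copy //= !getE //; set x := V np * _.
(* The quotient [Lw / Lw] is [1], or [0] when [Lw] is [0], so one comparison tests both
   conditions. *)
have -> : (0 < x) = (V Lw != 0) && (0 < V np).
  rewrite /x; have [->|w0] := eqVneq (V Lw) 0; first by rewrite mul0r mulr0 ltxx.
  by rewrite divff ?mulr1.
rewrite andbA; case: (_ && (0 < V np)) => /=; last first.
  by split; [move=> [[|r] i] // _; rewrite !getE | rewrite !getE].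
case: (V best < _); last first.
  by split; [move=> [[|r] i] // _; rewrite !getE | rewrite !getE].
split; first by move=> [[|[|r]] i] // _; rewrite /setrow /= !getE.
split; first by rewrite /setrow /= !getE.
by rewrite rowpoly_setrow; apply: eq_poly => i _; rewrite !getE.
Qed.

Definition sign_ratio q : R := wneg sp q / wpos sp q.

Lemma run_leaf l V : let V' := run (leaf_code k l) V in
  let w := rowpoly V (wrow l) in let q := balance sp (rowpoly V (prow l)) w in
  (forall a, (2 < a.1)%N -> V' a = V a) /\
  if [&& wsum sp w != 0, 0 < wpos sp q & V best < sign_ratio q]
  then V' best = sign_ratio q /\ rowpoly V' 1 = q
  else V' best = V best /\ rowpoly V' 1 = rowpoly V 1.
Proof.
cbv zeta; rewrite /leaf_code 4!run_cons run_nil.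
have [] := run_sums (l.*2.+2) (l.*2.+3) V; move: (run _ V) => V1 e1 e2 ag1.
have [] := run_balance (l.*2) (l.*2.+1) V1; move: (run _ V1) => V2 e3 ag2.
have [] := run_count V2; move: (run _ V2) => V3 e4 e5 ag3.
have [] := run_keep V3; move: (run _ V3) => V4 ag4.
rewrite e3 e1 e2 !(agree_rowpoly ag1) // -/(balance sp _ _) in e4 e5 *.
have -> : V3 Lw = wsum sp (rowpoly V (wrow l)) by rewrite ag3 // ag2.
have -> : V3 best = V best by rewrite ag3 // ag2 // ag1.
rewrite e4 e5 -/(sign_ratio _) => res; split.
  move=> [[|[|[|r]]] i] // _; rewrite ag4 // ag3 // ag2 // ag1 //.
have e1' : rowpoly V3 1 = rowpoly V 1.
  rewrite (agree_rowpoly ag3) // -(agree_rowpoly ag1) //.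
  by apply: eq_rowpoly => i _; apply: ag2.
have e2' : rowpoly V3 2 = rowpoly V2 2 by rewrite (agree_rowpoly ag3).
by move: res; rewrite e1' e2' e3 !(agree_rowpoly ag1) // e1 e2.
Qed.

(** Rows from [3] up to [prow l] belong to the enclosing levels of the search; the rows below [3]
    are shared by all levels. *)
Definition keeps_below l V V' := forall a, (2 < a.1 < prow l)%N -> V' a = V a.

Lemma run_step l ce e V : let V' := run (step_code k l ce) V in
  let p := rowpoly V (prow l) in let w := rowpoly V (wrow l) in
  let x := V (node_loc k l) in
  (forall V, run ce V ep = e /\ agree [:: ep; zr] V (run ce V)) ->
  [/\ rowpoly V' (prow l.+1) = newton p w x e,
      rowpoly V' (wrow l.+1) = add_root k w x,
      keeps_below l.+1 V V' /\ V' (node_loc k l) = x,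
      V' best = V best & rowpoly V' 1 = rowpoly V 1].
Proof.
move=> V' p w x ceE; rewrite /V' /step_code 8!run_cons run_nil.
rewrite [run (eval_code _ _ _ (prow l)) _]run_eval // -/p -/x.
have [] := ceE (setv V ev p.[x]); move: (run ce _) => V2 e2 ag2.
rewrite !run_op run_eval // !getE // e2 (ag2 ev) // (ag2 (node_loc k l)) //.
rewrite (agree_rowpoly ag2) // !getE // -/w -/x run_lit.
set V5 := setv (setv (setv V2 _ _) _ _) _ _.
have ag5 : agree [:: ev; ep; zr; cf] V V5.
  move=> a; rewrite !inE !negb_or => /and4P[a1 a2 a3 a4].
  by rewrite /V5 !setv_ne // ag2 ?inE ?negb_or ?a2 ?a3 // setv_ne.
have p5 : V5 cf = (e - p.[x]) / w.[x] by rewrite /V5 setv_eq.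
clearbody V5.
have x5 : V5 (node_loc k l) = x by apply: ag5.
rewrite run_axpy; last first.
- by [].
- by rewrite /=; lia.
- by rewrite /=; lia.
set V6 := setrow _ _ _ _.
have V6n a : a.1 != prow l.+1 -> V6 a = V5 a.
  by move=> na; rewrite /V6 /setrow (negPf na).
have x6 : V6 (node_loc k l) = x by rewrite /V6 /setrow /= ltnn andbF.
rewrite run_add_root; last first.
- by rewrite /=; lia.
- by [].
- by rewrite /=; lia.
have W6 : rowpoly (setv V6 zr 0) (wrow l) = w.
  rewrite getE // /w -(agree_rowpoly ag5) //.
  by apply: eq_rowpoly => i _; apply: V6n; rewrite /=; lia.
set V8 := setrow _ _ _ _.
have V8n a : a.1 != wrow l.+1 -> a != zr -> V8 a = V6 a.
  by move=> na nz; rewrite /V8 /setrow (negPf na) /= setv_ne.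
split.
- transitivity (rowpoly V6 (prow l.+1)).
    by apply: eq_rowpoly => i _; apply: V8n; rewrite //=; lia.
  by rewrite rowpoly_setrow rowpoly_axpy !(agree_rowpoly ag5) // p5.
- rewrite rowpoly_setrow rowpoly_add_root ?setv_eq // W6.
  by rewrite setv_ne // x6.
- split; last by rewrite V8n //=; lia.
  move=> [[|r] i] //= /andP[r2 rl]; rewrite V8n //=; last by lia.
  by rewrite V6n /=; [apply: ag5|lia].
- by rewrite V8n // V6n // ag5.
- by rewrite -(agree_rowpoly ag5).
Qed.

Hypothesis weights_gt0 : {in sp, forall x : R * R, 0 < x.2}.

Lemma sign_ratio_ge0 q : 0 <= sign_ratio q.
Proof.
rewrite /sign_ratio divr_ge0 // /wneg /wpos big_seq_cond sumr_ge0 // => x;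
  by move=> /andP[xsp _]; apply/ltW/weights_gt0.
Qed.

(* The initial value [-1] of [best] lies below every [sign_ratio]. *)
Definition sound V : Prop :=
  V best = -1 \/
  [/\ wsum sp (rowpoly V 1) = 0, 0 < wpos sp (rowpoly V 1)
    & V best = sign_ratio (rowpoly V 1)].

Lemma sound_ext V V' : V' best = V best -> rowpoly V' 1 = rowpoly V 1 ->
  sound V -> sound V'.
Proof. by rewrite /sound => -> ->. Qed.

Definition searched j p w V V' : Prop :=
  [/\ sound V', V best <= V' best
    & forall q, candidate sp k j p w q -> 0 < wpos sp q -> sign_ratio q <= V' best].

Lemma run_leaf_searched l V : sound V ->
  let V' := run (leaf_code k l) V in
  (forall a, (2 < a.1)%N -> V' a = V a) /\
  searched 0 (rowpoly V (prow l)) (rowpoly V (wrow l)) V V'.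
Proof.
move=> sV; have [] := run_leaf l V; cbv zeta; move: (run _ V) => V' keep res.
split=> //.
set q := balance _ _ _ in res.
case: ifP res => [/and3P[w0 pos lt_b] [e1 e2]|no [e1 e2]].
  split.
  - by right; rewrite e1 e2; split=> //; apply: wsum_balance.
  - by rewrite e1 ltW.
  - by move=> q' [[_ ->]|[]] _; rewrite e1.
split.
- exact: sound_ext sV.
- by rewrite e1.
move=> q' [[w0 ->]|[]] pos; move: no; rewrite w0 pos /= e1 => /negbT.
by rewrite -leNgt.
Qed.

Lemma keeps_below_trans l V1 V2 V3 :
  keeps_below l V1 V2 -> keeps_below l V2 V3 -> keeps_below l V1 V3.
Proof. by move=> k12 k23 a la; rewrite k23 ?k12. Qed.

Lemma keeps_below_rowpoly l V V' : keeps_below l.+1 V V' ->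
  rowpoly V' (prow l) = rowpoly V (prow l) /\ rowpoly V' (wrow l) = rowpoly V (wrow l).
Proof.
by move=> kb; split; apply: eq_rowpoly => i _; apply: kb; rewrite /=; lia.
Qed.

Section Body.
Variables (j l : nat).
(** The induction hypothesis of [run_search], isolated to treat the loop body. *)
Hypothesis search_ok : forall V, sound V ->
  let V' := run (search_code k j l.+1) V in
  keeps_below l.+2 V V' /\
  searched j (rowpoly V (prow l.+1)) (rowpoly V (wrow l.+1)) V V'.

Lemma run_try ce e V : sound V ->
  (forall V, run ce V ep = e /\ agree [:: ep; zr] V (run ce V)) ->
  let V' := run (search_code k j l.+1) (run (step_code k l ce) V) in
  let x := V (node_loc k l) in
  [/\ keeps_below l.+1 V V', V' (node_loc k l) = x
    & searched j (newton (rowpoly V (prow l)) (rowpoly V (wrow l)) x e)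
        (add_root k (rowpoly V (wrow l)) x) V V'].
Proof.
move=> sV ceE V' x.
have [e1 e2 [kb1 n1] b1 r1] := run_step l V ceE.
have [|kb2 [s2 le2 c2]] := search_ok (V := run (step_code k l ce) V).
  exact: sound_ext sV.
split.
- apply: keeps_below_trans kb1 _ => a la; apply: kb2; move: la; lia.
- by rewrite -[RHS]n1; apply: kb2; rewrite /=; lia.
- by split=> //; [rewrite -b1 | rewrite -e1 -e2].
Qed.

Lemma run_body V : sound V ->
  let V' := run (cseq (flatten [seq [:: step_code k l ce; search_code k j l.+1]
                        | ce <- sign_codes])) V in
  let x := V (node_loc k l) in
  [/\ keeps_below l.+1 V V', sound V', V best <= V' best
    & forall e q, e \in [:: 0; 1; -1] ->
        candidate sp k j (newton (rowpoly V (prow l)) (rowpoly V (wrow l)) x e)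
          (add_root k (rowpoly V (wrow l)) x) q ->
        0 < wpos sp q -> sign_ratio q <= V' best].
Proof.
move=> sV; rewrite /sign_codes [flatten _]/= 6!run_cons run_nil.
have [|kb1 n1 [s1 le1 c1]] := @run_try (CLit ep 0) 0 V sV.
  by move=> U; rewrite !runE !getE; split=> //; apply: agree_setv.
move: (run (search_code k j l.+1) _) kb1 n1 s1 le1 c1 => V1 kb1 n1 s1 le1 c1.
have [|kb2 n2 [s2 le2 c2]] := @run_try (CLit ep 1) 1 V1 s1.
  by move=> U; rewrite !runE !getE; split=> //; apply: agree_setv.
move: (run (search_code k j l.+1) _) kb2 n2 s2 le2 c2 => V2 kb2 n2 s2 le2 c2.
have [|kb3 n3 [s3 le3 c3]] :=
    @run_try (cseq [:: CLit ep 1; CLit zr 0; COp RSub ep zr ep]) (-1) V2 s2.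
  move=> U; rewrite !runE /= !getE // sub0r; split=> //.
  by do !apply: agree_setv.
move: (run (search_code k j l.+1) _) kb3 n3 s3 le3 c3 => V3 kb3 n3 s3 le3 c3.
have kb12 := keeps_below_trans kb1 kb2.
have [p1 w1] := keeps_below_rowpoly kb1.
have [p2 w2] := keeps_below_rowpoly kb12.
split=> //.
- exact: keeps_below_trans kb12 kb3.
- by apply: le_trans le1 (le_trans le2 le3).
(* Bounds from earlier signs survive because [best] never decreases; later tries see the same rows
   and node because level [l] is preserved. *)
move=> e q; rewrite !inE => /or3P[] /eqP-> cand pos.
- exact: le_trans (c1 q cand pos) (le_trans le2 le3).
- by apply: le_trans (c2 q _ pos) le3; rewrite p1 w1 n1.
- by apply: (c3 q _ pos); rewrite p2 w2 n2 n1.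
Qed.

End Body.

Lemma search_codeS j l : search_code k j.+1 l =
  CSeq (leaf_code k l) (CFor (node_loc k l) mu
    (cseq (flatten [seq [:: step_code k l ce; search_code k j l.+1]
                   | ce <- sign_codes]))).
Proof. by []. Qed.

Lemma run_search j l V : sound V ->
  let V' := run (search_code k j l) V in
  keeps_below l.+1 V V' /\
  searched j (rowpoly V (prow l)) (rowpoly V (wrow l)) V V'.
Proof.
elim: j l V => [|j IH] l V sV.
  have [keep ser] := run_leaf_searched l sV; split=> // a la; apply: keep; lia.
cbv zeta; rewrite search_codeS run_seq run_for.
have [keep [s1 le1 c1]] := run_leaf_searched l sV.
move: (run (leaf_code k l) V) keep s1 le1 c1 => V1 keep s1 le1 c1.
have kb1 : keeps_below l.+1 V V1 by move=> a la; apply: keep; lia.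
have [p1 w1] := keeps_below_rowpoly kb1.
set F := (X in foldl X).
have FE U x : sound U -> [/\ keeps_below l.+1 U (F U x), sound (F U x),
    U best <= F U x best
    & forall e q, e \in [:: 0; 1; -1] ->
        candidate sp k j (newton (rowpoly U (prow l)) (rowpoly U (wrow l)) x.1 e)
          (add_root k (rowpoly U (wrow l)) x.1) q ->
        0 < wpos sp q -> sign_ratio q <= F U x best].
  move=> sU; rewrite /F; set U' := setv _ _ _.
  have sU' : sound U' by apply: sound_ext sU; rewrite /U' !getE.
  have kb : keeps_below l.+1 U U'.
    move=> [r i] /= la; rewrite /U' !setv_ne //; rewrite xpair_eqE; lia.
  have nU' : U' (node_loc k l) = x.1 by rewrite /U' !getE.
  have [p' w'] := keeps_below_rowpoly kb.
  have [kb2 s2 le2 c2] := run_body (IH l.+1) sU'.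
  split=> //; first exact: keeps_below_trans kb kb2.
  by move: c2; rewrite nU' p' w'.
have loop s U : sound U -> [/\ keeps_below l.+1 U (foldl F U s), sound (foldl F U s),
    U best <= foldl F U s best
    & forall x e q, x \in s -> e \in [:: 0; 1; -1] ->
        candidate sp k j (newton (rowpoly U (prow l)) (rowpoly U (wrow l)) x.1 e)
          (add_root k (rowpoly U (wrow l)) x.1) q ->
        0 < wpos sp q -> sign_ratio q <= foldl F U s best].
  elim: s U => [|x s IHs] U sU //=.
  have [kbF sF leF cF] := FE U x sU.
  have [kb' s' le' c'] := IHs _ sF; have [pF wF] := keeps_below_rowpoly kbF.
  split=> //; first exact: keeps_below_trans kbF kb'.
    exact: le_trans leF le'.
  move=> y e q; rewrite inE => /predU1P[->|ys] eb cand pos.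
    exact: le_trans (cF e q eb cand pos) le'.
  by apply: (c' y e q ys eb _ pos); rewrite pF wF.
have [kb2 s2 le2 c2] := loop sp V1 s1.
split; first exact: keeps_below_trans kb1 kb2.
split=> //; first exact: le_trans le1 le2.
move=> q [bal|[x [e [xsp eb cand]]]] pos.
  by apply: le_trans le2; apply: c1 => //; left.
by apply: (c2 x e q xsp eb _ pos); rewrite p1 w1.
Qed.

Lemma run_main : let V := run (main_code k) (fun=> 0) in
  sound V /\
  forall q, (size q <= k.+1)%N -> wsum sp q = 0 -> 0 < wpos sp q ->
    sign_ratio q <= V best.
Proof.
cbv zeta; rewrite /main_code 5!run_cons run_nil !run_lit run_op /= !getE // sub0r.
set V := setv _ (wrow 0, _) _.
have sV : sound V by left; rewrite /V !getE.
have [_ [s' _ c']] := run_search k 0 sV; split=> // q szq Lq pos.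
have [r cand sgr] := candidate_complete weights_gt0 szq Lq pos.
have -> : sign_ratio q = sign_ratio r.
  by rewrite /sign_ratio -(eq_wpos sgr) -(eq_wneg sgr).
have pos_r : 0 < wpos sp r by rewrite (eq_wpos sgr).
apply: c' => //.
have -> : rowpoly V (prow 0) = 0.
  by apply/polyP => i; rewrite coef_poly coef0 /V !getE // if_same.
have -> // : rowpoly V (wrow 0) = 1.
apply/polyP => i; rewrite coef_poly coef1 /V /setv /=.
by case: i => [|i] //=; rewrite if_same.
Qed.

End Specs.

(** * Input, output and running time *)

Section Spectrum.
Variables (R : realType) (n : nat) (lam : n.-tuple R).
Implicit Types p : {poly R}.

Definition spectrum : seq (R * R) := [seq (x.1, x.2%:R) | x <- tally lam].

Lemma spectrum_gt0 : {in spectrum, forall x : R * R, 0 < x.2}.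
Proof.
move=> _ /mapP[x xt ->] /=; rewrite ltr0n lt0n.
have /andP[_ n0] := tallyP lam.
by apply: contraNneq n0 => <-; apply: map_f.
Qed.

Lemma size_spectrum : (size spectrum <= n)%N.
Proof.
rewrite size_map -(size_map fst) (perm_size (tallyEl lam)).
by rewrite (leq_trans (size_undup _)) ?size_tuple.
Qed.

Lemma sum_spectrum (f : R -> R) :
  \sum_(x <- spectrum) x.2 * f x.1 = \sum_(i < n) f (tnth lam i).
Proof.
rewrite -(big_tuple _ _ lam predT f) -(perm_big _ (tallyK lam)) /=.
rewrite /spectrum big_map /tally_seq big_flatten big_map /=.
by apply: eq_bigr => x _; rewrite big_nseq iter_addr_0 mulr_natl.
Qed.

Lemma card_spectrum (P : pred R) :
  (#|[set i | P (tnth lam i)]|)%:R = \sum_(x <- spectrum | P x.1) x.2 :> R.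
Proof.
rewrite -sum1_card natr_sum big_mkcond /=.
rewrite (eq_bigr (fun i => if P (tnth lam i) then 1 else 0)); last first.
  by move=> i _; rewrite inE.
rewrite -(sum_spectrum (fun x => if P x then 1 else 0)) [RHS]big_mkcond.
by apply: eq_bigr => x _; case: ifP; rewrite ?mulr1 ?mulr0.
Qed.

Lemma npos_wpos p : (npos lam p)%:R = wpos spectrum p.
Proof. exact: (card_spectrum (fun x => 0 < p.[x])). Qed.

Lemma nneg_wneg p : (nneg lam p)%:R = wneg spectrum p.
Proof. exact: (card_spectrum (fun x => p.[x] < 0)). Qed.

Lemma objective_ratio p : objective lam p = 1 + sign_ratio spectrum p.
Proof. by rewrite /objective npos_wpos nneg_wneg. Qed.

Lemma feasibleP k p :
  feasible k lam p <->
  [/\ (size p <= k.+1)%N, wsum spectrum p = 0 & 0 < wpos spectrum p].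
Proof.
rewrite /feasible -npos_wpos ltr0n lt0n /wsum.
by rewrite (sum_spectrum (fun x => p.[x])).
Qed.

End Spectrum.

Lemma nth_flatten_pairs (T S : Type) (x0 : S) (f g : T -> S) (s : seq T) (y : T) i :
  (i < size s)%N ->
  nth x0 (flatten [seq [:: f x; g x] | x <- s]) i.*2 = f (nth y s i) /\
  nth x0 (flatten [seq [:: f x; g x] | x <- s]) i.*2.+1 = g (nth y s i).
Proof. by elim: s i => [//|x s IH] [|i] //= /IH. Qed.

(** * The machine program with its setup and output *)

Section Wrapper.
Variable k : nat.

Definition bound : nat :=
  maxn (loc_bound (main_code k))
       (maxn (pickle (best : loc)).+1 (\max_(i < k.+1) (pickle (1%N, i : nat)).+1)).

(** Register 0 holds the end of the input by then. Register 2 receives the address of the zero cell,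
    and the next ones the consecutive addresses of the locations. *)
Fixpoint setup_code (m : nat) : cmd :=
  if m is m'.+1 then
    Seq (setup_code m')
      (Seq (ILit m'.+2 (k.+2 + m')) (IOp IAdd m'.+2 m'.+2 0))
  else Skip.

Fixpoint output_code (m : nat) : cmd :=
  if m is m'.+1 then
    Seq (output_code m') (Seq (ILit 1 m'.+1) (RMov 1 (lreg (1, m')%N)))
  else Skip.

(* Work cells start at address [2 * size sp + k + 2], beyond both the input and
   the output area, which may overlap each other. *)
Definition program : cmd :=
  Seq (IOp IAdd 0 0 0)
  (Seq (ILit 1 1)
  (Seq (setup_code bound.+1)
  (Seq (RLit 2 0)
  (Seq (compile bound 0 (main_code k))
  (Seq (If (RLt (lreg best) 2) (ILit 0 0) (ILit 0 1))
  (Seq (ILit 1 0)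
  (Seq (RLit 1 1)
  (Seq (ROp RAdd 1 1 (lreg best))
       (output_code k.+1))))))))).

Variable R : realType.
Implicit Types s : state R.

Lemma exec_setup m s : exists s', [/\ exec (setup_code m) s (m.*2.+1) s',
    rmem s' = rmem s, ireg s' 0%N = ireg s 0%N, ireg s' 1%N = ireg s 1%N
  & forall i, (i < m)%N -> ireg s' i.+2 = (k.+2 + i + ireg s 0%N)%N].
Proof.
elim: m => [|m [s' [ex e0 e1 e2 e3]]] /=.
  by exists s; split=> //; constructor.
pose s1 := set_ireg s' m.+2 (k.+2 + m)%N.
exists (set_ireg s1 m.+2 (iop_eval IAdd (ireg s1 m.+2) (ireg s1 0%N))); split=> //.
  have -> : m.+1.*2.+1 = (m.*2.+1 + (1 + 1))%N by lia.
  apply: exec_Seq ex _; apply: (@exec_Seq _ _ s1 _ _ _ 1 1); first exact: exec_ILit.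
  exact: exec_IOp.
move=> i; rewrite ltnS leq_eqVlt /= /upd !eqSS => /predU1P[->|lti].
  by rewrite eqxx e1.
by rewrite (ltn_eqF lti) e3.
Qed.

(** Outputs go to cells [1] to [m]; with [m < base] they reach neither the work cells nor the
    objective value in cell [0]. *)
Lemma exec_output base (V : loc -> R) m s :
  (forall i, (i < m)%N -> ireg s (lreg (1, i)%N) = (base + (pickle (1%N, i)).+1)%N /\
     rmem s (base + (pickle (1%N, i)).+1)%N = V (1, i)%N) ->
  (m < base)%N ->
  exists s', [/\ exec (output_code m) s (m.*2.+1) s',
      ireg s' 0%N = ireg s 0%N, (forall l, ireg s' (lreg l) = ireg s (lreg l)),
      (forall a, (a == 0%N) || (base <= a)%N -> rmem s' a = rmem s a)
    & forall i, (i < m)%N -> rmem s' i.+1 = V (1, i)%N].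
Proof.
elim: m => [|m IH] sV ltb /=.
  by exists s; split=> //; constructor.
have [|s' [ex e0 el ea ei]] := IH _ (ltnW ltb).
  by move=> i lti; apply: sV; apply: ltnW.
have [rm vm] := sV m (ltnSn m).
pose s1 := set_ireg s' 1%N m.+1.
have c1 : cell s1 (lreg (1, m)%N) = V (1, m)%N.
  by rewrite /cell /= /upd /= el rm ea ?vm // leq_addr orbT.
exists (set_cell s1 1%N (cell s1 (lreg (1, m)%N))); split=> //.
- have -> : m.+1.*2.+1 = (m.*2.+1 + (1 + 1))%N by lia.
  apply: exec_Seq ex _; apply: (@exec_Seq _ _ s1 _ _ _ 1 1); first exact: exec_ILit.
  exact: exec_RMov.
- move=> a ha; have far : (a == m.+1) = false by move: ha; lia.
  by rewrite /= /upd /= far ea.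
- move=> i; rewrite ltnS leq_eqVlt c1 /= /upd /= eqSS.
  by move=> /predU1P[->|lti]; rewrite ?eqxx // (ltn_eqF lti) ei.
Qed.

Lemma bound_best : (pickle (best : loc) < bound)%N.
Proof. by rewrite /bound !leq_max leqnn !orbT. Qed.

Lemma bound_row i : (i <= k)%N -> (pickle (1%N, i) < bound)%N.
Proof.
rewrite -ltnS => lei; rewrite /bound !leq_max.
rewrite -[i in pickle (1%N, i)]/(nat_of_ord (Ordinal lei)).
by rewrite (leq_bigmax (F := fun i : 'I_k.+1 => (pickle (1%N, i : nat)).+1)) !orbT.
Qed.

Lemma exec_program n (lam : n.-tuple R) :
  let V := run (spectrum lam) (main_code k) (fun=> 0) in
  exists t s, [/\ exec program (spectrum_input lam) t s,
    (t <= (bound.+1).*2 + k.+1.*2 + 12 + cost (size (spectrum lam)) (main_code k))%N,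
    ireg s 0%N = if V best < 0 then 0%N else 1%N, rmem s 0%N = 1 + V best
  & forall j, (j <= k)%N -> rmem s j.+1 = V (1, j)%N].
Proof.
set sp := spectrum lam; set N := size sp; move=> V.
set s0 := spectrum_input lam.
have N0 : ireg s0 0%N = N by rewrite /= /upd /= /N size_map.
pose s1 := set_ireg s0 0%N (iop_eval IAdd (ireg s0 0%N) (ireg s0 0%N)).
pose s2 := set_ireg s1 1%N 1%N.
have [s3 [ex3 m3 r30 r31 r3]] := exec_setup bound.+1 s2.
have {}r30 : ireg s3 0%N = N.*2 by rewrite r30 /= /upd /= -addnn -N0.
have {}r31 : ireg s3 1%N = 1%N by rewrite r31.
have s20 : ireg s2 0%N = N.*2 by rewrite /= /upd /= -addnn -N0.
rewrite s20 in r3.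
pose s4 := set_cell s3 2%N 0%:R.
pose base := (N.*2 + k.+2)%N.
have r32 : ireg s3 2%N = base by rewrite (r3 0%N) // addn0 addnC.
have far a : a != base -> rmem s4 a = rmem s0 a.
  by move=> na; rewrite /= /upd r32 (negPf na) m3.
have node i : (i < N)%N -> rmem s0 i.*2 = (nth (0, 0) sp i).1 /\
    rmem s0 i.*2.+1 = (nth (0, 0) sp i).2.
  rewrite /N size_map => lti; rewrite (nth_map (0, 0%N)) //=.
  exact: (nth_flatten_pairs 0 (fun x : R * nat => x.1) (fun x => x.2%:R) (0, 0%N) lti).
have rep4 : represents bound sp base (fun=> 0) s4.
  split=> //=.
  - by rewrite /upd r32 eqxx.
  - by move=> l lM; rewrite (r3 (pickle l).+1) //; rewrite /base; lia.
  (* Work cells lie beyond the input list, whose default value is [0], so the zero valuation is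
     represented. *)
  - move=> l lM; rewrite [LHS]far; last by lia.
    rewrite /= nth_default // size_flatten /shape -map_comp.
    have -> : [seq (size \o (fun x : R * nat => [:: x.1; x.2%:R])) i | i <- tally lam]
            = nseq (size (tally lam)) 2 by elim: (tally lam) => //= ? ? ->.
    rewrite sumn_nseq /base /N /sp size_map; lia.
  - move=> i lti; rewrite [LHS]far ?(proj1 (node _ _)) //.
    by rewrite /base -/N in lti *; lia.
  - move=> i lti; rewrite [LHS]far ?(proj2 (node _ _)) //.
    by rewrite /base -/N in lti *; lia.
have lb : (loc_bound (main_code k) <= bound)%N by rewrite /bound leq_maxl.
have gb : ((size sp).*2 <= base)%N by rewrite /base leq_addr.
have [t5 [s5 [ex5 le5 rep5 _]]] := compile_correct gb 0 lb rep4.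
rewrite -/V in rep5.
have cb : cell s5 (lreg best) = V best by apply: rep_cell rep5 bound_best.
have cz : cell s5 2 = 0 by apply: rep_cell0 rep5.
pose s6 := set_ireg s5 0%N (if V best < 0 then 0%N else 1%N).
pose s7 := set_ireg s6 1%N 0%N.
pose s8 := set_cell s7 1%N 1%:R.
pose s9 := set_cell s8 1%N (rop_eval RAdd (cell s8 1%N) (cell s8 (lreg best))).
have ex6 : exec (If (RLt (lreg best) 2) (ILit 0 0) (ILit 0 1)) s5 2 s6.
  rewrite /s6; case: ifP => Vb.
    by apply: exec_IfT; [rewrite /= cb cz | constructor].
  by apply: exec_IfF; [rewrite /= cb cz Vb | constructor].
have m9 a : a != 0%N -> rmem s9 a = rmem s5 a.
  by move=> na; rewrite /= /upd /= (negPf na).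
have r9 l : ireg s9 (lreg l) = ireg s5 (lreg l) by [].
have c81 : cell s8 1%N = 1 by rewrite /cell /= /upd /=.
have c8b : cell s8 (lreg best) = V best.
  rewrite -cb /cell /= /upd /= (rep_reg rep5 bound_best).
  by case: eqP => //; rewrite /base; lia.
have m90 : rmem s9 0%N = 1 + V best.
  by rewrite /s9 c81 c8b /= /upd /=.
have [||s10 [ex10 r10 _ m10 o10]] := @exec_output base V k.+1 s9 _ _.
- move=> i lti; rewrite r9 m9; last by rewrite /base; lia.
  by rewrite (rep_reg rep5) ?(rep_loc rep5) // bound_row.
- by rewrite /base; lia.
exists (1 + (1 + (bound.+1.*2.+1 +
  (1 + (t5 + (2 + (1 + (1 + (1 + k.+1.*2.+1)))))))))%N.
exists s10; split.
- apply: exec_Seq; first exact: exec_IOp.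
  apply: exec_Seq; first exact: exec_ILit.
  apply: exec_Seq ex3 _.
  apply: exec_Seq; first exact: exec_RLit.
  apply: exec_Seq ex5 _.
  apply: exec_Seq ex6 _.
  apply: exec_Seq; first exact: exec_ILit.
  apply: exec_Seq; first exact: exec_RLit.
  apply: exec_Seq ex10; exact: exec_ROp.
- by move: le5; rewrite -/N; lia.
- by rewrite r10 /= /upd /=.
- by rewrite m10.
- by move=> j lej; rewrite o10.
Qed.

Lemma program_solves n (lam : n.-tuple R) s :
  let V := run (spectrum lam) (main_code k) (fun=> 0) in
  ireg s 0%N = (if V best < 0 then 0%N else 1%N) -> rmem s 0%N = 1 + V best ->
  (forall j, (j <= k)%N -> rmem s j.+1 = V (1, j)%N) ->
  solves_nu k lam s.
Proof.
move=> V r0 m0 mj.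
have := run_main k (@spectrum_gt0 _ _ lam); cbv zeta; rewrite -/V => -[sV maxV].
have ge0 q : 0 <= sign_ratio (spectrum lam) q by apply/sign_ratio_ge0/spectrum_gt0.
(* If [best] is still [-1], a feasible polynomial would contradict [maxV], as ratios are
   nonnegative. *)
case: sV => [b|[L pos b]].
  right; split; last by rewrite r0 b oppr_lt0 ltr01.
  move=> [p /feasibleP[szp Lp posp]]; have := maxV p szp Lp posp.
  by rewrite b leNgt (lt_le_trans (ltrN10 _)).
left; exists (rowpoly k V 1); split.
- split; first by apply/feasibleP; split=> //; apply: size_poly.
  move=> q /feasibleP[szq Lq posq].
  by rewrite !objective_ratio lerD2l -b maxV.
- by rewrite r0 b ltNge ge0.
- by rewrite m0 objective_ratio b.
- by move=> j lej; rewrite mj // coef_poly ltnS lej.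
Qed.

End Wrapper.

Lemma leq_wexp2r m n D : (m <= n)%N -> (m ^ D <= n ^ D)%N.
Proof. by case: D => // D le_mn; rewrite leq_exp2r. Qed.

(** [n.+1] is at most [2 * n] for positive [n]; the summand [1] covers [n = 0]. *)
Lemma expnS_bound n D : (n.+1 ^ D <= 2 ^ D * n ^ D + 1)%N.
Proof.
case: n => [|n]; first by rewrite exp1n addn1.
by rewrite -expnMn (leq_trans _ (leq_addr _ _)) // leq_wexp2r //; lia.
Qed.

Theorem theorem4p7 (R : realType) (k : nat) :
  exists (prog : cmd) (C a : nat),
  forall (n : nat) (e : rel 'I_n) (lam : n.-tuple R),
    symmetric e -> irreflexive e ->
    partially_walk_regular R k e ->
    adjacency_eigenvalues e lam ->
    exists (t : nat) (s : state R),
      [/\ exec prog (spectrum_input lam) t s,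
          (t <= C * n ^ a + C)%N
        & solves_nu k lam s].
Proof.
set c := main_code k; set D := loop_depth c; set K := code_size c.
(* The [K * 2 ^ D] pays for the growing part of the search, the rest for its constant part and for
   setup and output. *)
exists (program k), ((bound k).+1.*2 + k.+1.*2 + 12 + K * 2 ^ D + K)%N, D.
move=> n e lam _ _ _ _.
have [t [s [ex le_t r0 m0 mj]]] := @exec_program k R n lam.
exists t, s; split=> //; last exact: program_solves r0 m0 mj.
apply: leq_trans le_t _; set K0 := (_ + _ + 12)%N.
have leN : (cost (size (spectrum lam)) c <= K * (2 ^ D * n ^ D + 1))%N.
  apply: leq_trans (cost_bound _ _) _; rewrite leq_mul2l; apply/orP; right.
  apply: leq_trans (expnS_bound _ _).
  by rewrite leq_wexp2r // ltnS size_spectrum.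
apply: leq_trans (leq_add (leqnn K0) leN) _.
by move: (2 ^ D)%N (n ^ D)%N => x y; nia.
Qed.
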